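(* Let $\Lambda$ be a semigroup as in the context and fix an integer $s_0\ge1$. The set $j_{s_0}(H_\Lambda^* )\setminus\bigcup_{0\ne\theta\le\sigma}j_{s_0}(H_{\Lambda\cap\theta^\perp})$ is a finite disjoint union of locally closed subsets, as follows: $$j_{s_0}(H_\Lambda^* )\setminus\bigcup_{0\ne\theta\le\sigma}j_{s_0}(H_{\Lambda\cap\theta^\perp})=\bigsqcup_{k=1}^d\ \bigsqcup_{\tau\in\mathcal{D}_k}\ \bigsqcup_{[(\nu,s_0)]\in A_{k,\tau}/\sim}j_{s_0}(H^*_{\Lambda,\nu}).$$
   Context: $M$ is a lattice of rank $d$, $N$ its dual lattice. $\Lambda\subset M$ is a finitely generated sub-semigroup (containing $0$) which generates $M$ as a group and such that $\sigma^\vee:=\mathbb{R}_{\ge0}\Lambda\subset M_{\mathbb{R}}$ is a strictly convex cone of dimension $d$; $\sigma\subset N_{\mathbb{R}}$ is the dual cone. $e_1,\dots,e_n$ is the minimal system of generators of $\Lambda$. $Z^\Lambda:=\mathrm{Spec}\,\mathbb{C}[\Lambda]\subset\mathbb{A}^n_{\mathbb{C}}$ via $x_i=X^{e_i}$; $0$ is the origin. $\mathring\tau$ denotes relative interior; $\theta\le\sigma$ means $\theta$ is a face of $\sigma$. $H_\Lambda$ is the set of arcs $\mathrm{Spec}\,\mathbb{C}[[t]]\to Z^\Lambda$ with origin $0$; $H_\Lambda^*$ is the subset of arcs $h$ with $X^u\circ h\ne0$ for all $u\in\Lambda$; $H_{\Lambda\cap\theta^\perp}\subset H_\Lambda$ consists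 of the arcs factoring through the orbit closure $Z^{\Lambda\cap\theta^\perp}\subset Z^\Lambda$; for $\nu\in\mathring\sigma\cap N$, $H^*_{\Lambda,\nu}=\{h\in H^*_\Lambda\mid\mathrm{ord}_t(X^u\circ h)=\langle\nu,u\rangle\ \forall u\in\Lambda\}$. $j_s$ is truncation mod $t^{s+1}$ to the space $H_s(Z^\Lambda)$ of $s$-jets. For $1\le k\le d$, $\mathcal{J}_k=\{e_{i_1}+\cdots+e_{i_k}\mid e_{i_1}\wedge\cdots\wedge e_{i_k}\ne0,\ 1\le i_1<\cdots<i_k\le n\}$, $\mathcal{N}(\mathcal{J}_k)$ is the convex hull of $\mathcal{J}_k+\sigma^\vee$, $\mathrm{ord}_{\mathcal{J}_k}(\nu)=\inf_{\omega\in\mathcal{N}(\mathcal{J}_k)}\langle\nu,\omega\rangle$ for $\nu\in\sigma$; the face of $\mathcal{N}(\mathcal{J}_k)$ defined by $\nu$ is the set where this infimum is attained. $\Sigma_k$ is the dual fan of $\mathcal{N}(\mathcal{J}_k)$ (a subdivision of $\sigma$ whose cones' relative interiors consist of vectors defining the same face), and $\bigcap_{i=1}^k\Sigma_i:=\{\bigcap_{i=1}^k\tau_i\mid\tau_i\in\Sigma_i\}$. For $\tau\in\bigcap_{i=1}^k\Sigma_i$, $\mathcal{F}_\tau$ is the face of $\mathcal{N}(\mathcal{J}_k)$ defined by any $\nu\in\mathring\tau$. $\mathcal{D}_k$ is the set of cones $\tau\in\bigcap_{i=1}^k\Sigma_i$ such that the face $\mathcal{F}_\tau$ of $\mathcal{N}(\mathcal{J}_k)$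 is contained in the interior of $\sigma^\vee$. Set $\phi_1=\mathrm{ord}_{\mathcal{J}_1}$, $\phi_k=\mathrm{ord}_{\mathcal{J}_k}-\mathrm{ord}_{\mathcal{J}_{k-1}}$ for $2\le k\le d$, $\phi_{d+1}=+\infty$. $A_k:=\{(\nu,s)\mid\nu\in\mathring\sigma\cap N,\ s\in\mathbb{Z}_{>0},\ \phi_k(\nu)\le s<\phi_{k+1}(\nu)\}$ and, for $\tau\in\bigcap_{i=1}^k\Sigma_i$, $A_{k,\tau}:=\{(\nu,s)\in A_k\mid\nu\in\mathring\tau\}$. On $A_k$, $(\nu,s)\sim(\nu',s')$ means $s=s'$ and, for all $1\le j\le k$, $\nu,\nu'$ define the same face of $\mathcal{N}(\mathcal{J}_j)$ and $\mathrm{ord}_{\mathcal{J}_j}(\nu)=\mathrm{ord}_{\mathcal{J}_j}(\nu')$; $[(\nu,s)]$ is the class of $(\nu,s)$. In the formula the innermost union is over the classes in $A_{k,\tau}/\sim$ whose second coordinate is $s_0$. *)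

(* Defs.v *)
From HB Require Import structures.
From mathcomp Require Import all_boot all_order all_algebra.
From mathcomp Require Import all_classical all_reals.
From mathcomp Require Import topology normedtype convex.
From mathcomp Require Import complex.
(* The notations of mpoly conflict with those of MathComp-Analysis. *)
From mathcomp Require Import -(notations) mpoly.

Set Implicit Arguments.
Unset Strict Implicit.
Unset Printing Implicit Defensive.

Import Order.TTheory GRing.Theory Num.Theory.
Import numFieldNormedType.Exports.

Local Open Scope classical_set_scope.
Local Open Scope ring_scope.

Record fps (K : comNzRingType) := Fps { fps_coef : nat -> K }.

Section FpsRing.
Variable K : comNzRingType.

HB.instance Definition _ := [isNew for @fps_coef K].
HB.instance Definition _ := [Choice of fps K by <:].

Implicit Types f g h : fps K.

Lemma fpsP f g : (forall i, fps_coef f i = fps_coef g i) -> f = g.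
Proof.
by case: f g => [f] [g] /= fg; congr Fps; apply/funext.
Qed.

Definition fps_zero : fps K := Fps (fun=> 0).
Definition fps_opp f : fps K := Fps (fun i => - fps_coef f i).
Definition fps_add f g : fps K := Fps (fun i => fps_coef f i + fps_coef g i).

Lemma fps_addA : associative fps_add.
Proof. by move=> f g h; apply: fpsP => i /=; rewrite addrA. Qed.
Lemma fps_addC : commutative fps_add.
Proof. by move=> f g; apply: fpsP => i /=; rewrite addrC. Qed.
Lemma fps_add0 : left_id fps_zero fps_add.
Proof. by move=> f; apply: fpsP => i /=; rewrite add0r. Qed.
Lemma fps_addN : left_inverse fps_zero fps_opp fps_add.
Proof. by move=> f; apply: fpsP => i /=; rewrite addNr. Qed.

HB.instance Definition _ :=
  GRing.isZmodule.Build (fps K) fps_addA fps_addC fps_add0 fps_addN.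

Definition fps_const (c : K) : fps K := Fps (fun i => if i == 0%N then c else 0).
Definition fps_mul f g : fps K :=
  Fps (fun n => \sum_(i < n.+1) fps_coef f i * fps_coef g (n - i)).

Let trunc n f : {poly K} := \poly_(i < n.+1) fps_coef f i.

Let truncE n f i : (i <= n)%N -> (trunc n f)`_i = fps_coef f i.
Proof. by move=> lein; rewrite coef_poly ltnS lein. Qed.

Let trunc_mul n f g i : (i <= n)%N ->
  fps_coef (fps_mul f g) i = (trunc n f * trunc n g)`_i.
Proof.
move=> lein; rewrite coefM; apply: eq_bigr => j _.
have leji : (j <= i)%N by rewrite -ltnS.
by rewrite !truncE // ?(leq_trans leji) // (leq_trans (leq_subr _ _)).
Qed.

Lemma fps_mulA : associative fps_mul.
Proof.
move=> f g h; apply: fpsP => n.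
rewrite (@trunc_mul n) // (@trunc_mul n (fps_mul f g)) //.
transitivity ((trunc n f * (trunc n g * trunc n h))`_n).
  rewrite !coefM; apply: eq_bigr => j _; congr (_ * _).
  by rewrite truncE ?leq_subr // (@trunc_mul n) // leq_subr.
rewrite mulrA !coefM; apply: eq_bigr => j _; congr (_ * _).
have lejn : (j <= n)%N by rewrite -ltnS.
by rewrite truncE // (@trunc_mul n).
Qed.

Lemma fps_mulC : commutative fps_mul.
Proof.
by move=> f g; apply: fpsP => n; rewrite !(@trunc_mul n) // mulrC.
Qed.

Lemma fps_mul1 : left_id (fps_const 1) fps_mul.
Proof.
move=> f; apply: fpsP => n /=.
rewrite big_ord_recl /= mul1r subn0 big1 ?addr0 // => i _.
by rewrite mul0r.
Qed.

Lemma fps_mulDl : left_distributive fps_mul fps_add.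
Proof.
move=> f g h; apply: fpsP => n /=.
by rewrite -big_split; apply: eq_bigr => i _; rewrite mulrDl.
Qed.

Lemma fps_oner_neq0 : fps_const 1 != 0.
Proof.
by apply/eqP => /(congr1 (fun f => fps_coef f 0%N)) /= /eqP; rewrite oner_eq0.
Qed.

HB.instance Definition _ := GRing.Zmodule_isComNzRing.Build (fps K)
  fps_mulA fps_mulC fps_mul1 fps_mulDl fps_oner_neq0.

End FpsRing.

Definition has_order (K : comNzRingType) (f : fps K) (z : int) : Prop :=
  exists m : nat, [/\ z = m%:Z, fps_coef f m != 0 &
    forall i, (i < m)%N -> fps_coef f i = 0].

Section Zariski.
Variables (K : fieldType) (a b : nat).

Definition zariski_closed (Z : set 'M[K]_(a, b)) : Prop :=
  exists P : set (mpoly (a * b) K),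
    Z = [set x | forall p, P p -> meval (fun i => mxvec x 0 i) p = 0].

Definition locally_closed_in (X S : set 'M[K]_(a, b)) : Prop :=
  exists F G, [/\ zariski_closed F, zariski_closed G & S = X `&` (F `\` G)].

End Zariski.

(* M = 'rV[int]_d is the lattice, its dual N is identified with 'rV[int]_d
   through [pairing], and M_R, N_R are both 'rV[R]_d. *)

Definition submonoid (V : zmodType) (S : set V) : Prop :=
  S 0 /\ forall x y, S x -> S y -> S (x + y).

Definition subgroup (V : zmodType) (S : set V) : Prop :=
  S 0 /\ forall x y, S x -> S y -> S (x - y).

Definition minimal_generators (V : zmodType) (n : nat) (e : 'I_n -> V)
    (S : set V) : Prop :=
  smallest (@submonoid V) (range e) = S /\
  forall I : {set 'I_n},
    smallest (@submonoid V) (e @` [set i | i \in I]) = S -> I = [set: 'I_n]%SET.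

Definition pairing (K : comNzRingType) (d : nat) (nu u : 'rV[K]_d) : K :=
  \sum_(i < d) nu 0 i * u 0 i.

Section ConvexGeometry.
Variables (R : realType) (d : nat).
Implicit Types (A K : set 'rV[R]_d).

Definition real_of_lattice (u : 'rV[int]_d) : 'rV[R]_d := map_mx intr u.

Definition cone_hull A : set 'rV[R]_d :=
  smallest [set K | submonoid K /\
    forall (c : R) x, 0 <= c -> K x -> K (c *: x)] A.

Definition strictly_convex K : Prop := K `&` [set x | K (- x)] = [set 0].

(* the linear span of K has dimension m *)
Definition has_dim K (m : nat) : Prop :=
  exists V : {vspace 'rV[R]_d}, [/\ (forall x, K x -> x \in V),
    (forall W : {vspace 'rV[R]_d}, (forall x, K x -> x \in W) -> (V <= W)%VS) &
    \dim V = m].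

Definition dual_cone K : set 'rV[R]_d :=
  [set nu | forall w, K w -> 0 <= pairing nu w].

Definition is_face (theta K : set 'rV[R]_d) : Prop :=
  exists2 w, dual_cone K w & theta = [set nu | K nu /\ pairing nu w = 0].

Definition affine_hull A : set 'rV[R]_d :=
  smallest [set K | forall (t : R) x y,
    K x -> K y -> K ((1 - t) *: x + t *: y)] A.

Definition convex_hull A : set 'rV[R]_d :=
  smallest (@convex_set R 'rV[R]_d) A.

Definition relint K : set 'rV[R]_d :=
  [set x | K x /\ \forall y \near x, affine_hull K y -> K y].

End ConvexGeometry.

Section LogJacobian.
Variables (R : realType) (d n : nat) (L : set 'rV[int]_d).
Variable e : 'I_n -> 'rV[int]_d.

Local Notation toR := (@real_of_lattice R d).

Definition sigma_dual : set 'rV[R]_d := cone_hull (toR @` L).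
Definition sigma : set 'rV[R]_d := dual_cone sigma_dual.

(* The coordinates of v_1 /\ ... /\ v_k with respect to the canonical basis of
   the k-th exterior power are the values at increasing g; the value at any
   other g is 0 or, up to sign, one of these. *)
Definition wedge k (v : 'I_k -> 'rV[int]_d) : {ffun {ffun 'I_k -> 'I_d} -> int} :=
  [ffun g : {ffun 'I_k -> 'I_d} => \det (\matrix_(a, b) v a 0 (g b))].

Definition Jset (k : nat) : set 'rV[int]_d :=
  [set u | exists f : 'I_k -> 'I_n,
     [/\ {homo f : a b / (a < b)%N}, wedge (e \o f) != 0 &
         u = \sum_(a < k) e (f a)]].

Definition newton (k : nat) : set 'rV[R]_d :=
  convex_hull [set x | exists u w, [/\ Jset k u, sigma_dual w & x = toR u + w]].

Definition ordJ (k : nat) (nu : 'rV[R]_d) : R :=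
  inf [set pairing nu w | w in newton k].

Definition face_of (k : nat) (nu : 'rV[R]_d) : set 'rV[R]_d :=
  [set w | newton k w /\ pairing nu w = ordJ k nu].

Definition dual_fan (k : nat) : set (set 'rV[R]_d) :=
  [set tau | exists2 nu, sigma nu &
     tau = [set nu' | sigma nu' /\
              forall w, face_of k nu w -> pairing nu' w = ordJ k nu']].

Definition meet_fan (k : nat) : set (set 'rV[R]_d) :=
  [set tau | exists T : nat -> set 'rV[R]_d,
     (forall i, (1 <= i <= k)%N -> dual_fan i (T i)) /\
     tau = \bigcap_(i in [set i | (1 <= i <= k)%N]) T i].

(* face_of k nu does not depend on the choice of nu in relint tau *)
Definition Dset (k : nat) : set (set 'rV[R]_d) :=
  [set tau | meet_fan k tau /\
     exists2 nu, relint tau nu & face_of k nu `<=` interior sigma_dual].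

Definition phi (k : nat) (nu : 'rV[R]_d) : \bar R :=
  if k == 1%N then (ordJ 1 nu)%:E
  else if (k <= d)%N then (ordJ k nu - ordJ k.-1 nu)%:E
  else +oo%E.

Definition Aset (k : nat) : set ('rV[int]_d * nat) :=
  [set x | [/\ relint sigma (toR x.1), (0 < x.2)%N,
     (phi k (toR x.1) <= x.2%:R%:E)%E &
     (x.2%:R%:E < phi k.+1 (toR x.1))%E]].

Definition Aset_in (k : nat) (tau : set 'rV[R]_d) : set ('rV[int]_d * nat) :=
  [set x | Aset k x /\ relint tau (toR x.1)].

Definition Aequiv (k : nat) (x y : 'rV[int]_d * nat) : Prop :=
  x.2 = y.2 /\ forall j, (1 <= j <= k)%N ->
    face_of j (toR x.1) = face_of j (toR y.1) /\
    ordJ j (toR x.1) = ordJ j (toR y.1).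

(* the elements of A_{k,tau}/~ whose second coordinate is s *)
Definition Aclasses (k : nat) (tau : set 'rV[R]_d) (s : nat) :
    set (set ('rV[int]_d * nat)) :=
  [set c | exists x, [/\ Aset_in k tau x, x.2 = s &
     c = [set y | Aset_in k tau y /\ Aequiv k x y]]].

End LogJacobian.

Arguments sigma_dual R {d} L _.
Arguments sigma R {d} L _.
Arguments Dset R {d n} L e k _.
Arguments Aclasses R {d n} L e k tau s _.

Section Arcs.
Variables (R : realType) (d n : nat) (L : set 'rV[int]_d).
Variable e : 'I_n -> 'rV[int]_d.

Local Notation C := (R[i]).
Local Notation toR := (@real_of_lattice R d).

Definition weight (m : multinom n) : 'rV[int]_d := \sum_(i < n) e i *+ m i.

(* When P is L the map x_i |-> X^{e_i} has this kernel; when P is the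
   intersection of L with the orthogonal of a face, it is the kernel of the
   composition of that map with X^u |-> (X^u if u is in P, 0 otherwise), so
   that it defines Spec C[P] as a closed subscheme of Spec C[L]. *)
Definition toric_ideal (P : set 'rV[int]_d) : set (mpoly n C) :=
  [set f | forall u, P u -> \sum_(m <- msupp f | weight m == u) mcoeff m f = 0].

Definition arcs (P : set 'rV[int]_d) : set ('I_n -> fps C) :=
  [set h | (forall f, toric_ideal P f -> mmap (@fps_const C) h f = 0) /\
           (forall i, fps_coef (h i) 0 = 0)].

Definition perp (theta : set 'rV[R]_d) : set 'rV[int]_d :=
  [set u | forall nu, theta nu -> pairing nu (toR u) = 0].

(* mmap1 h m is the composition of X^u with h, for u = weight m, and weight
   maps the exponents m onto L. *)
Definition arcs_star : set ('I_n -> fps C) :=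
  [set h | arcs L h /\ forall m, mmap1 h m != 0].

Definition arcs_ord (nu : 'rV[int]_d) : set ('I_n -> fps C) :=
  [set h | arcs_star h /\
     forall m, has_order (mmap1 h m) (pairing nu (weight m))].

Definition jet (s : nat) (h : 'I_n -> fps C) : 'M[C]_(n, s.+1) :=
  \matrix_(i, j) fps_coef (h i) j.

Definition jet_lift (s : nat) (J : 'M[C]_(n, s.+1)) : 'I_n -> fps C :=
  fun i => Fps (fun j => if (j <= s)%N then J i (inord j) else 0).

Definition jet_space (s : nat) : set 'M[C]_(n, s.+1) :=
  [set J | forall f, toric_ideal L f ->
     forall j, (j <= s)%N -> fps_coef (mmap (@fps_const C) (jet_lift J) f) j = 0].

End Arcs.

Arguments arcs R {d n} e P _.
Arguments arcs_star R {d n} L e _.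
Arguments arcs_ord R {d n} L e nu _.
Arguments jet R {n} s h.
Arguments jet_space R {d n} L e s _.

(* Main.v *)
Require Import Defs.
From HB Require Import structures.
From mathcomp Require Import all_boot all_order all_algebra.
From mathcomp Require Import all_classical all_reals.
From mathcomp Require Import interval_inference topology normedtype convex.
From mathcomp Require Import complex ring lra zify.
From mathcomp Require Import -(notations) mpoly.

(** The s0-jet of an arc of the torus of order [nu] remembers the values of [nu]
    on the generators [e i] up to s0: the coordinate of index [i] of the jet has
    order <nu, e i> when this is at most s0, and vanishes otherwise. Call these
    the truncated values of [nu]. Conversely, the arcs of order [nu] are the
    [t ^ <nu, e i> * v_i] where the units [v_i] satisfy all the relations
    v^m = v^m' between exponents of the same weight, so that the set of jets of
    arcs of order [nu] depends only on the truncated values ([arcs_ord_units],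
    [jets_trunc]), and two such sets are disjoint when the truncated values
    differ ([common_jet_trunc]). Everything else translates conditions on
    truncated values into convex geometry.

    Let [k] be the rank of the set [low nu s0] of the generators of value at most
    s0. The generators form a matroid, and ord_{J_j}(nu) is the minimal weight
    of an independent set of [j] generators. Exchanging elements of minimal
    sets shows that phi_j(nu) <= s0 exactly when j <= k, so that (nu, s0) lies
    in A_k ([Aset_rank]), and that minimal sets of size j <= k consist of
    elements of [low nu s0] ([min_set_low]). Hence the truncated values
    determine ord_{J_j} and the faces defined by [nu] for j <= k
    ([trunc_eq_face]); conversely these data determine the values of [nu] on a
    greedily chosen basis of the span of [low nu s0], thus all truncated values
    ([face_eq_trunc]). So the classes of A_k correspond to truncated values.
    The faces also determine the cone of the intersection of the fans that has
    [nu] in its relative interior ([relint_meet_fan], [relint_fan_cone]).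
    Disjointness and finiteness follow.

    The jet of an arc of order [nu] comes from the orbit closure of a face theta
    exactly when theta is orthogonal to [low nu s0] ([jet_orbit_closure]). A
    minimal vertex of the face of N(J_k) defined by [nu] is the sum of a basis
    of the span of [low nu s0], so an element of sigma vanishes at some point of
    that face if and only if it is orthogonal to [low nu s0]; by Farkas' lemma
    the points of the cone not in its interior are those at which some nonzero
    element of sigma vanishes. Thus the excluded jets are those for which the
    face is not contained in the interior ([face_not_interior]).

    For local closedness, a jet of the right orders has to be lifted to an arc
    as soon as its unit parts, known to a precision that depends on the
    coordinate, satisfy each relation to the precision to which it makes sense
    ([lift_units]). These are polynomial equations. A unit is its constant term
    together with its logarithmic derivative, on which the relations become
    additive; the values prescribed on some generators are then extended to
    homomorphisms from the lattice into divisible groups, the multiplicative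
    and the additive group of the complex field, by means of the Smith normal
    form ([divisible_extension]). *)

Set Implicit Arguments.
Unset Strict Implicit.
Unset Printing Implicit Defensive.

Import Order.TTheory GRing.Theory Num.Theory.
Import numFieldNormedType.Exports.

Local Open Scope classical_set_scope.
Local Open Scope ring_scope.

(** * Formal power series *)

Section PowerSeries.
Variable K : comNzRingType.
Implicit Types f g h : fps K.

Lemma fps_coefM f g k :
  fps_coef (f * g) k = \sum_(i < k.+1) fps_coef f i * fps_coef g (k - i).
Proof. by []. Qed.

Lemma fps_coefD f g k : fps_coef (f + g) k = fps_coef f k + fps_coef g k.
Proof. by []. Qed.

Lemma fps_coef0 k : fps_coef (0 : fps K) k = 0.
Proof. by []. Qed.

Lemma fps_coef1 k : fps_coef (1 : fps K) k = (k == 0%N)%:R.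
Proof. by rewrite /=; case: eqP. Qed.

Lemma fps_coef_sum (I : Type) (r : seq I) (P : pred I) (F : I -> fps K) k :
  fps_coef (\sum_(i <- r | P i) F i) k =
  \sum_(i <- r | P i) fps_coef (F i) k.
Proof. exact: (big_morph (fun f => fps_coef f k)). Qed.

Lemma fps_coefMn f m k : fps_coef (f *+ m) k = fps_coef f k *+ m.
Proof. by elim: m => // m IHm; rewrite !mulrS fps_coefD IHm. Qed.

Lemma fps_coefM0 f g : fps_coef (f * g) 0 = fps_coef f 0 * fps_coef g 0.
Proof. by rewrite fps_coefM big_ord1. Qed.

Lemma fps_coefX0 f m : fps_coef (f ^+ m) 0 = fps_coef f 0 ^+ m.
Proof. by elim: m => [|m IHm] //; rewrite !exprS fps_coefM0 IHm. Qed.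

Lemma fps_coef_prod0 (I : Type) (r : seq I) (P : pred I) (F : I -> fps K) :
  fps_coef (\prod_(i <- r | P i) F i) 0 =
  \prod_(i <- r | P i) fps_coef (F i) 0.
Proof. exact: (big_morph (fun f => fps_coef f 0) fps_coefM0). Qed.

Lemma fps_coef_constM (c : K) f k :
  fps_coef (fps_const c * f) k = c * fps_coef f k.
Proof.
rewrite fps_coefM big_ord_recl /= subn0 big1 ?addr0 // => i _.
by rewrite mul0r.
Qed.

Definition fps_mon m : fps K := Fps (fun j => (j == m)%:R).

Lemma fps_coef_monM m f k :
  fps_coef (fps_mon m * f) k =
  if (k < m)%N then 0 else fps_coef f (k - m).
Proof.
rewrite fps_coefM /=; case: ltnP => km.
  rewrite big1 // => i _; case: eqP => [im|_]; last by rewrite mul0r.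
  by have := ltn_ord i; rewrite im ltnS leqNgt km.
rewrite (bigD1 (inord m)) //= inordK // eqxx mul1r big1 ?addr0 // => i.
case: (eqVneq (i : nat) m) => [<-|_ _]; last by rewrite mul0r.
by rewrite inord_val eqxx.
Qed.

Lemma fps_monD a b : fps_mon (a + b) = fps_mon a * fps_mon b.
Proof.
apply: fpsP => k; rewrite fps_coef_monM /=; case: ltnP => ka.
  by rewrite ltn_eqF // (leq_trans ka) // leq_addr.
by rewrite -{1}(subnKC ka) eqn_add2l.
Qed.

Lemma fps_mon0 : fps_mon 0 = 1.
Proof. by apply: fpsP => k; rewrite fps_coef1. Qed.

Lemma fps_monX a m : fps_mon a ^+ m = fps_mon (a * m)%N.
Proof.
elim: m => [|m IHm]; first by rewrite [(a * 0)%N]muln0 fps_mon0.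
by rewrite exprS IHm -fps_monD mulnS.
Qed.

Lemma fps_mon_inj m : injective ( *%R (fps_mon m)).
Proof.
move=> f g fg; apply: fpsP => k.
have := congr1 (fun h => fps_coef h (m + k)) fg.
by rewrite !fps_coef_monM -ltn_subRL subnn ltn0 addKn.
Qed.

Definition fps_eqmod r f g := forall k, (k < r)%N -> fps_coef f k = fps_coef g k.

Lemma fps_eqmodxx r f : fps_eqmod r f f. Proof. by []. Qed.

Lemma fps_eqmod_sym r f g : fps_eqmod r f g -> fps_eqmod r g f.
Proof. by move=> fg k /fg. Qed.

Lemma fps_eqmodD r f f' g g' :
  fps_eqmod r f f' -> fps_eqmod r g g' -> fps_eqmod r (f + g) (f' + g').
Proof. by move=> ff gg k kr; rewrite !fps_coefD ff ?gg. Qed.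

Lemma fps_eqmodM r f f' g g' :
  fps_eqmod r f f' -> fps_eqmod r g g' -> fps_eqmod r (f * g) (f' * g').
Proof.
move=> ff gg k kr; rewrite !fps_coefM; apply: eq_bigr => i _.
by rewrite ff ?gg // (leq_ltn_trans _ kr) ?leq_subr // -ltnS.
Qed.

Lemma fps_eqmodX r f g m : fps_eqmod r f g -> fps_eqmod r (f ^+ m) (g ^+ m).
Proof.
by move=> fg; elim: m => // m IHm; rewrite !exprS; apply: fps_eqmodM.
Qed.

Lemma fps_eqmod_prod r (I : Type) (s : seq I) (P : pred I) (F G : I -> fps K) :
  (forall i, P i -> fps_eqmod r (F i) (G i)) ->
  fps_eqmod r (\prod_(i <- s | P i) F i) (\prod_(i <- s | P i) G i).
Proof.
move=> FG; apply: (big_ind2 (fps_eqmod r)) => // f f' g g'.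
exact: fps_eqmodM.
Qed.

Lemma fps_eqmod_sum r (I : Type) (s : seq I) (P : pred I) (F G : I -> fps K) :
  (forall i, P i -> fps_eqmod r (F i) (G i)) ->
  fps_eqmod r (\sum_(i <- s | P i) F i) (\sum_(i <- s | P i) G i).
Proof.
move=> FG; apply: (big_ind2 (fps_eqmod r)) => // f f' g g'.
exact: fps_eqmodD.
Qed.

Definition fps_order m f :=
  fps_coef f m != 0 /\ forall i, (i < m)%N -> fps_coef f i = 0.

Lemma fps_order_uniq m m' f : fps_order m f -> fps_order m' f -> m = m'.
Proof.
move=> [fm f0] [fm' f0']; apply/eqP; rewrite eqn_leq; apply/andP; split.
  by rewrite leqNgt; apply: contraNN fm' => /f0 ->.
by rewrite leqNgt; apply: contraNN fm => /f0' ->.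
Qed.

Lemma fps_orderP m f : fps_order m f <->
  exists2 v, f = fps_mon m * v & fps_coef v 0 != 0.
Proof.
split=> [[fm f0]|[v -> v0]]; last first.
  by split=> [|i im]; rewrite fps_coef_monM ?ltnn ?subnn ?im.
exists (Fps (fun j => fps_coef f (m + j))); last by rewrite /= addn0.
apply: fpsP => k; rewrite fps_coef_monM; case: ltnP => [/f0 //|mk].
by rewrite /= subnKC.
Qed.

Lemma fps_neq0_order f : f != 0 -> exists m, fps_order m f.
Proof.
move=> /eqP f0; have /existsNP [k /eqP fk] : ~ forall k, fps_coef f k = 0.
  by move=> fk; apply: f0; apply: fpsP => k; rewrite fk.
have ex : exists k, fps_coef f k != 0 by exists k.
exists (ex_minn ex); case: ex_minnP => m fm mmin; split=> // i im.
by apply/eqP/negPn/negP => /mmin; rewrite leqNgt im.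
Qed.

Lemma has_orderE m f : has_order f m%:Z <-> fps_order m f.
Proof.
split=> [[m' [/eqP]]|[fm f0]]; last by exists m.
by rewrite eqz_nat => /eqP ->.
Qed.

End PowerSeries.

Arguments fps_mon {K} m.

(** Serves to solve the equation u' = g u coefficient by coefficient, for [u]
    when [g] is given and for [g] when [u] is given. *)
Lemma strong_recursion (T : Type) (Phi : seq T -> T) :
  exists f : nat -> T, forall m, f m = Phi (mkseq f m).
Proof.
pose s m := iter m (fun r => rcons r (Phi r)) [::].
exists (fun m => Phi (s m)) => m; congr Phi.
elim: m => //= m IHm.
by rewrite {1}IHm /mkseq -addn1 iotaD map_cat cats1.
Qed.

Section LogarithmicDerivative.
Variable K : numFieldType.
Implicit Types (f g h u v : fps K).

Definition fps_deriv f : fps K := Fps (fun k => k.+1%:R * fps_coef f k.+1).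

(** [dlog u g] says that [g] is the logarithmic derivative u'/u; as a relation
    it spares the inverse of a series. *)
Definition dlog u g := fps_deriv u = g * u.

Lemma fps_derivM f g :
  fps_deriv (f * g) = fps_deriv f * g + f * fps_deriv g.
Proof.
apply: fpsP => k; rewrite fps_coefD /= mulr_sumr.
transitivity (\sum_(i < k.+2) (i%:R * fps_coef f i * fps_coef g (k.+1 - i)) +
              \sum_(i < k.+2) (fps_coef f i * ((k.+1 - i)%:R *
                 fps_coef g (k.+1 - i)))).
  rewrite -big_split /=; apply: eq_bigr => i _.
  have ik : (i <= k.+1)%N by rewrite -ltnS.
  rewrite -{1}(subnKC ik) natrD; ring.
congr (_ + _).
  rewrite big_ord_recl /= !mul0r add0r; apply: eq_bigr => i _.
  by rewrite /bump /= add1n subSS.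
rewrite big_ord_recr /= subnn mul0r mulr0 addr0; apply: eq_bigr => i _.
by rewrite subSn // -ltnS.
Qed.

Lemma fps_deriv1 : fps_deriv 1 = 0.
Proof. by apply: fpsP => k /=; rewrite mulr0. Qed.

Lemma dlog1 : dlog 1 0.
Proof. by rewrite /dlog fps_deriv1 mul0r. Qed.

Lemma dlogM u v g h : dlog u g -> dlog v h -> dlog (u * v) (g + h).
Proof. by rewrite /dlog fps_derivM => -> ->; ring. Qed.

Lemma dlogX u g m : dlog u g -> dlog (u ^+ m) (g *+ m).
Proof.
move=> ug; elim: m => [|m IHm]; first by rewrite expr0 mulr0n; apply: dlog1.
by rewrite exprS mulrS; apply: dlogM.
Qed.

Lemma dlog_prod (I : Type) (r : seq I) (P : pred I) (U G : I -> fps K) :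
  (forall i, P i -> dlog (U i) (G i)) ->
  dlog (\prod_(i <- r | P i) U i) (\sum_(i <- r | P i) G i).
Proof.
move=> UG; apply: (big_ind2 dlog) => //; first exact: dlog1.
by move=> u g v h; apply: dlogM.
Qed.

Lemma dlog_coef u g k : dlog u g ->
  k.+1%:R * fps_coef u k.+1 = \sum_(i < k.+1) fps_coef g i * fps_coef u (k - i).
Proof. by move=> /(congr1 (fun f => fps_coef f k)). Qed.

Lemma dlog_exists u : fps_coef u 0 != 0 -> exists g, dlog u g.
Proof.
move=> u0.
have [g gE] := strong_recursion (fun s : seq K =>
  (fps_coef u 0)^-1 * ((size s).+1%:R * fps_coef u (size s).+1 -
     \sum_(i < size s) s`_i * fps_coef u (size s - i))).
exists (Fps g); apply: fpsP => k; rewrite fps_coefM big_ord_recr /= subnn.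
have -> : g k * fps_coef u 0 = k.+1%:R * fps_coef u k.+1 -
     \sum_(i < k) g i * fps_coef u (k - i).
  rewrite gE !size_mkseq mulrAC mulVf // mul1r; congr (_ - _).
  by apply: eq_bigr => i _; rewrite nth_mkseq.
by rewrite addrC subrK.
Qed.

Lemma dlog_surj c g : exists2 u, fps_coef u 0 = c & dlog u g.
Proof.
have [u uE] := strong_recursion (fun s : seq K =>
  if size s is k.+1 then
    k.+1%:R^-1 * \sum_(i < k.+1) fps_coef g i * s`_(k - i) else c).
exists (Fps u); first by rewrite /= uE.
apply: fpsP => k /=; rewrite uE size_mkseq mulrA divff ?pnatr_eq0 // mul1r.
by apply: eq_bigr => i _; rewrite nth_mkseq // ltnS leq_subr.
Qed.

(** The coefficient of index [k.+1] of the equation u' = g u gives the one of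
    [u] in terms of the coefficients of index at most [k] of [u] and [g]: hence
    one more coefficient of agreement for the series than for the derivatives. *)
Lemma dlog_eqmod r u v g h : dlog u g -> dlog v h ->
    fps_coef u 0 = fps_coef v 0 -> fps_eqmod r g h ->
  fps_eqmod r.+1 u v.
Proof.
move=> ug vh uv0 gh; elim/ltn_ind => -[//|k] IHk kr.
apply: (mulfI (_ : k.+1%:R != 0)); first by rewrite pnatr_eq0.
rewrite (dlog_coef k ug) (dlog_coef k vh); apply: eq_bigr => i _.
have ik : (i <= k)%N by rewrite -ltnS.
rewrite gh ?(leq_ltn_trans ik) // IHk //; first by rewrite ltnS leq_subr.
by rewrite (leq_ltn_trans _ kr) // (leq_trans (leq_subr _ _)).
Qed.

Lemma dlog_inj u v g : dlog u g -> dlog v g ->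
  fps_coef u 0 = fps_coef v 0 -> u = v.
Proof. by move=> ug vg uv; apply: fpsP => k; apply: (@dlog_eqmod k u v g g). Qed.

(** The same recursion, solved for [g]. *)
Lemma eqmod_dlog r u v g h : dlog u g -> dlog v h ->
    fps_coef u 0 != 0 -> fps_eqmod r.+1 u v ->
  fps_eqmod r g h.
Proof.
move=> ug vh u0 uv; elim/ltn_ind => k IHk kr.
have := dlog_coef k vh; rewrite -uv // (dlog_coef k ug) !big_ord_recr /= subnn.
have -> : \sum_(i < k) fps_coef g i * fps_coef u (k - i) =
          \sum_(i < k) fps_coef h i * fps_coef v (k - i).
  apply: eq_bigr => i _; rewrite IHk ?(ltn_trans _ kr) // uv //.
  by rewrite ltnS (leq_trans (leq_subr _ _)) // ltnW.
by move/addrI; rewrite -uv // => /(mulIf u0).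
Qed.

End LogarithmicDerivative.

(** * Arcs on the toric variety *)

Section Pairing.
Variables (K : comNzRingType) (d : nat).
Implicit Types x y u w : 'rV[K]_d.

Lemma pairingDl x y w : pairing (x + y) w = pairing x w + pairing y w.
Proof. by rewrite /pairing -big_split; apply: eq_bigr => i _; rewrite mxE mulrDl. Qed.

Lemma pairingDr x u w : pairing x (u + w) = pairing x u + pairing x w.
Proof. by rewrite /pairing -big_split; apply: eq_bigr => i _; rewrite mxE mulrDr. Qed.

Lemma pairingZl c x w : pairing (c *: x) w = c * pairing x w.
Proof. by rewrite /pairing mulr_sumr; apply: eq_bigr => i _; rewrite mxE mulrA. Qed.

Lemma pairingZr c x w : pairing x (c *: w) = c * pairing x w.
Proof. by rewrite /pairing mulr_sumr; apply: eq_bigr => i _; rewrite mxE mulrCA. Qed.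

Lemma pairingC x w : pairing x w = pairing w x.
Proof. by apply: eq_bigr => i _; rewrite mulrC. Qed.

Lemma pairing0l w : pairing 0 w = 0.
Proof. by rewrite /pairing big1 // => i _; rewrite mxE mul0r. Qed.

Lemma pairing0r x : pairing x 0 = 0.
Proof. by rewrite /pairing big1 // => i _; rewrite mxE mulr0. Qed.

Lemma pairingNl x w : pairing (- x) w = - pairing x w.
Proof. by rewrite -scaleN1r pairingZl mulN1r. Qed.

Lemma pairingNr x w : pairing x (- w) = - pairing x w.
Proof. by rewrite -scaleN1r pairingZr mulN1r. Qed.

Lemma pairingBl x y w : pairing (x - y) w = pairing x w - pairing y w.
Proof. by rewrite pairingDl pairingNl. Qed.

Lemma pairingBr x u w : pairing x (u - w) = pairing x u - pairing x w.
Proof. by rewrite pairingDr pairingNr. Qed.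

Lemma pairing_sumr x (I : Type) (r : seq I) (P : pred I) (F : I -> 'rV[K]_d) :
  pairing x (\sum_(i <- r | P i) F i) = \sum_(i <- r | P i) pairing x (F i).
Proof. by apply: (big_morph _ (pairingDr x) (pairing0r x)). Qed.

End Pairing.

Section Monomials.
Variables (d n : nat) (e : 'I_n -> 'rV[int]_d).

Lemma weightD m m' : weight e (mnm_add m m') = weight e m + weight e m'.
Proof.
by rewrite /weight -big_split; apply: eq_bigr => i _; rewrite mnmDE mulrnDr.
Qed.

Lemma weight0 : weight e mnm0 = 0.
Proof. by rewrite /weight big1 // => i _; rewrite mnm0E. Qed.

Lemma weightU i : weight e (mnm1 i) = e i.
Proof.
rewrite /weight (bigD1 i) //= mnm1E eqxx big1 ?addr0 // => j ji.
by rewrite mnm1E eq_sym (negbTE ji).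
Qed.

Lemma mmap1_mul (S : comNzRingType) (h h' : 'I_n -> S) m :
  mmap1 (fun i => h i * h' i) m = mmap1 h m * mmap1 h' m.
Proof.
by rewrite /mmap1 -big_split; apply: eq_bigr => i _; rewrite exprMn.
Qed.

Definition mnm_dot (o : 'I_n -> nat) (m : multinom n) : nat :=
  (\sum_i m i * o i)%N.

Lemma mnm_dotD o m m' : mnm_dot o (mnm_add m m') = (mnm_dot o m + mnm_dot o m')%N.
Proof.
by rewrite /mnm_dot -big_split; apply: eq_bigr => i _; rewrite mnmDE mulnDl.
Qed.

Lemma mnm_dotU o i : mnm_dot o (mnm1 i) = o i.
Proof.
rewrite /mnm_dot (bigD1 i) //= mnm1E eqxx mul1n big1 ?addn0 // => j ji.
by rewrite mnm1E eq_sym (negbTE ji).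
Qed.

(** The binomials X^m - X^m' with m and m' of equal weight span the toric ideal,
    so these are the equations of the toric variety. *)
Definition binomial_rel (S : comNzRingType) (h : 'I_n -> S) :=
  forall m m', weight e m = weight e m' -> mmap1 h m = mmap1 h m'.

Lemma smallest_submonoid_weight u :
  smallest (@submonoid 'rV[int]_d) (range e) u <-> exists m, u = weight e m.
Proof.
split=> [|[m ->]].
  move=> /(_ [set u | exists m, u = weight e m]); apply.
  split=> [|u' [i _ <-]]; last first.
    by exists (mnm1 i); rewrite weightU.
  split; first by exists mnm0; rewrite weight0.
  by move=> x y [m ->] [m' ->]; exists (mnm_add m m'); rewrite weightD.
move=> M [[M0 MD] Me]; apply: (big_ind M) => // i _.
by elim: (m i) => // k IHk; rewrite mulrS; apply: MD => //; apply: Me; exists i.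
Qed.

Lemma mmap1_order (K : numFieldType) (h v : 'I_n -> fps K) (o : 'I_n -> nat) m :
    (forall i, h i = fps_mon (o i) * v i) ->
  mmap1 h m = fps_mon (mnm_dot o m) * mmap1 v m.
Proof.
move=> hv; have -> : mmap1 h m = mmap1 (fun i => fps_mon (o i) * v i) m.
  by apply: eq_bigr => i _; rewrite hv.
rewrite mmap1_mul; congr (_ * _); rewrite /mmap1 /mnm_dot.
elim/big_ind2: _ => [|a b a' b' -> ->|i _]; first by rewrite fps_mon0.
  by rewrite fps_monD.
by rewrite fps_monX mulnC.
Qed.

Lemma mmap1_coef0 (K : numFieldType) (v : 'I_n -> fps K) m :
  (forall i, fps_coef (v i) 0 != 0) -> fps_coef (mmap1 v m) 0 != 0.
Proof.
move=> v0; rewrite fps_coef_prod0; apply/prodf_neq0 => i _.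
by rewrite fps_coefX0 expf_neq0.
Qed.

Lemma mmap1_eqmod (K : numFieldType) r (h h' : 'I_n -> fps K) m :
  (forall i, fps_eqmod r (h i) (h' i)) -> fps_eqmod r (mmap1 h m) (mmap1 h' m).
Proof. by move=> hh; apply: fps_eqmod_prod => i _; apply: fps_eqmodX. Qed.

End Monomials.

Section ToricArcs.
Variables (R : realType) (d n : nat) (e : 'I_n -> 'rV[int]_d).
Local Notation C := (R[i]).
Implicit Types (P : set 'rV[int]_d) (h : 'I_n -> fps C).

Lemma toric_monomial P m : ~ P (weight e m) ->
  toric_ideal (R := R) e P (mpolyX C m).
Proof.
move=> Pm u Pu; rewrite msuppX big_mkcond big_seq1.
by case: eqP => // mu; move: Pm; rewrite mu.
Qed.

Lemma binomial_supp (V : nmodType) (F : multinom n -> C -> V) m m' : m != m' ->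
  \sum_(x <- msupp (mpolyX C m - mpolyX C m'))
     F x (mcoeff x (mpolyX C m - mpolyX C m')) = F m 1 + F m' (-1).
Proof.
move=> mm'; have ss : perm_eq (msupp (mpolyX C m - mpolyX C m')) [:: m; m'].
  have disj : [predI msupp (mpolyX C m) & msupp (- mpolyX C m')] =1 xpred0.
    move=> x /=; rewrite (perm_mem (msuppN _)) !msuppX !inE.
    by apply/andP => -[/eqP -> /eqP]; apply/eqP.
  apply: perm_trans (msuppD disj) _.
  by rewrite msuppX (perm_cat2l [:: m]) (permPl (msuppN _)) msuppX.
rewrite (perm_big _ ss) big_cons big_seq1 !mcoeffB !mcoeffX !eqxx.
by rewrite (negbTE mm') eq_sym (negbTE mm') subr0 sub0r.
Qed.

Lemma toric_binomial P m m' : weight e m = weight e m' ->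
  toric_ideal (R := R) e P (mpolyX C m - mpolyX C m').
Proof.
move=> ww; case: (eqVneq m m') => [-> | mm'] u Pu.
  by rewrite subrr msupp0 big_nil.
rewrite big_mkcond.
rewrite (binomial_supp (fun x c => if weight e x == u then c else 0) mm') ww.
by case: eqP; rewrite ?subrr ?addr0.
Qed.

Lemma mmap_monomial h m : mmap (@fps_const C) h (mpolyX C m) = mmap1 h m.
Proof.
rewrite /mmap msuppX big_seq1 mcoeffX eqxx; apply: fpsP => k.
by rewrite fps_coef_constM mul1r.
Qed.

Lemma mmap_binomial h m m' :
  mmap (@fps_const C) h (mpolyX C m - mpolyX C m') = mmap1 h m - mmap1 h m'.
Proof.
case: (eqVneq m m') => [-> | mm'].
  by rewrite !subrr /mmap msupp0 big_nil.
rewrite /mmap (binomial_supp (fun x c => fps_const c * mmap1 h x) mm').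
by apply: fpsP => k; rewrite !fps_coefD !fps_coef_constM mul1r mulN1r.
Qed.

Lemma mmap_toric P h :
    (forall m, ~ P (weight e m) -> mmap1 h m = 0) -> binomial_rel e h ->
  forall f, toric_ideal (R := R) e P f -> mmap (@fps_const C) h f = 0.
Proof.
move=> hP hb f fP; rewrite /mmap.
pose W := undup [seq weight e m | m <- msupp f].
transitivity (\sum_(m <- msupp f) \sum_(u <- W | weight e m == u)
    fps_const (mcoeff m f) * mmap1 h m).
  rewrite !big_seq; apply: eq_bigr => m mf; rewrite -big_filter.
  (* exactly one weight of the list matches that of [m] *)
  rewrite (_ : [seq u <- W | weight e m == u] = [:: weight e m]) ?big_seq1 //.
  rewrite (eq_filter (a2 := pred1 (weight e m))) => [|u]; last exact: eq_sym.
  by rewrite filter_pred1_uniq ?undup_uniq // mem_undup map_f.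
rewrite (exchange_big_dep xpredT) //= big1_seq // => u /=.
rewrite mem_undup => /mapP[m0 m0f ->].
rewrite (eq_bigr (fun m => fps_const (mcoeff m f) * mmap1 h m0)); last first.
  by move=> m /eqP /hb ->.
rewrite -mulr_suml; case: (pselect (P (weight e m0))) => [Pm0|/hP ->]; last first.
  by rewrite mulr0.
rewrite (_ : \sum_(_ <- _ | _) _ = 0) ?mul0r //; apply: fpsP => k.
rewrite fps_coef_sum fps_coef0; case: k => [|k]; last by rewrite big1.
exact: (fP _ Pm0).
Qed.

(** The ideal is graded by the weight, hence spanned by the monomials of weight
    outside [P] and by the binomials with members of equal weight. *)
Lemma arcsP P h : arcs R e P h <->
  [/\ forall i, fps_coef (h i) 0 = 0,
      forall m, ~ P (weight e m) -> mmap1 h m = 0 & binomial_rel e h].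
Proof.
split=> [[hP h0]|[h0 hP hb]]; last by split=> //; apply: mmap_toric.
split=> // [m /toric_monomial /hP|m m' /toric_binomial - /(_ P) /hP].
  by rewrite mmap_monomial.
by rewrite mmap_binomial => /subr0_eq.
Qed.

End ToricArcs.

Section ArcsOfGivenOrder.
Variables (R : realType) (d n : nat) (L : set 'rV[int]_d) (e : 'I_n -> 'rV[int]_d).
Hypothesis Le : smallest (@submonoid 'rV[int]_d) (range e) = L.
Local Notation C := (R[i]).
Implicit Types (h v : 'I_n -> fps C).

Lemma LP u : L u <-> exists m, u = weight e m.
Proof. by rewrite -Le; apply: smallest_submonoid_weight. Qed.

Lemma arcs_LP h : arcs R e L h <->
  (forall i, fps_coef (h i) 0 = 0) /\ binomial_rel e h.
Proof.
split=> [/arcsP [] //|[h0 hb]]; apply/arcsP; split=> // m [].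
by apply/LP; exists m.
Qed.

Lemma pairing_weight (nu : 'rV[int]_d) (o : 'I_n -> nat) m :
  (forall i, pairing nu (e i) = (o i)%:Z) ->
  pairing nu (weight e m) = (mnm_dot o m)%:Z.
Proof.
move=> nuo; rewrite /pairing.
under eq_bigr do rewrite summxE mulr_sumr.
rewrite exchange_big /= /mnm_dot raddf_sum; apply: eq_bigr => i _.
rewrite /= PoszM -nuo /pairing mulr_sumr; apply: eq_bigr => b _.
by rewrite mulmxnE -mulr_natl mulrCA natz.
Qed.

(** Dividing the coordinates by the powers of [t] given by [nu] leaves a point
    of the torus with values in the units of the ring of power series: the
    powers of [t] satisfy the binomial relations by themselves. *)
Lemma arcs_ordP (nu : 'rV[int]_d) (o : 'I_n -> nat) h :
    (forall i, pairing nu (e i) = (o i)%:Z) -> (forall i, 0 < o i)%N ->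
  arcs_ord R L e nu h <->
  exists v, [/\ forall i, h i = fps_mon (o i) * v i,
                forall i, fps_coef (v i) 0 != 0 & binomial_rel e v].
Proof.
move=> nuo o_gt0; split=> [[[/arcs_LP [h0 hb] hN0] hord]|[v [hv v0 vb]]].
  have /choice [v hv] : forall i, exists v : fps C,
      h i = fps_mon (o i) * v /\ fps_coef v 0 != 0.
    move=> i; have := hord (mnm1 i); rewrite mmap1U weightU nuo.
    by move=> /has_orderE /fps_orderP [w hw w0]; exists w.
  exists v; split=> [i|i|m m' mm']; [by case: (hv i)|by case: (hv i)|].
  have := hb _ _ mm'; have hv1 i := (hv i).1.
  rewrite !(mmap1_order _ hv1); have : mnm_dot o m = mnm_dot o m'.
    by apply/eqP; rewrite -eqz_nat -!(pairing_weight _ nuo) mm'.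
  by move=> ->; apply: fps_mon_inj.
have hord m : fps_order (mnm_dot o m) (mmap1 h m).
  apply/fps_orderP; exists (mmap1 v m); first exact: mmap1_order.
  exact: mmap1_coef0.
split=> [|m]; last by rewrite (pairing_weight _ nuo) has_orderE.
split=> [|m]; last first.
  by apply/eqP => hm; have [] := hord m; rewrite hm fps_coef0 eqxx.
apply/arcs_LP; split=> [i|m m' mm'].
  by rewrite hv fps_coef_monM o_gt0.
rewrite !(mmap1_order _ hv) (vb _ _ mm'); congr (fps_mon _ * _).
by apply/eqP; rewrite -eqz_nat -!(pairing_weight _ nuo) mm'.
Qed.

Hypothesis L_generates : smallest (@subgroup 'rV[int]_d) L = setT.

Lemma weight_diff u : exists m m', u = weight e m - weight e m'.
Proof.
have : smallest (@subgroup 'rV[int]_d) L u by rewrite L_generates.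
move=> /(_ [set u | exists m m', u = weight e m - weight e m']).
apply; split=> [|x /LP [m ->]]; last first.
  by exists m, mnm0; rewrite weight0 subr0.
split=> [|x y [m [m' ->]] [p [p' ->]]].
  by exists mnm0, mnm0; rewrite subrr.
exists (mnm_add m p'), (mnm_add m' p); rewrite !weightD opprB opprD.
by rewrite addrACA; congr (_ + _); rewrite addrC.
Qed.

(** Every lattice vector is a difference of two weights, which forces the value
    of the linear form there; the binomial relations make it well defined. *)
Lemma dot_linear (o : 'I_n -> nat) :
    (forall m m', weight e m = weight e m' -> mnm_dot o m = mnm_dot o m') ->
  exists nu : 'rV[int]_d, forall i, pairing nu (e i) = (o i)%:Z.
Proof.
move=> ow.
have /choice [mm mmP] : forall b : 'I_d, exists mm : multinom n * multinom n,
    delta_mx 0 b = weight e mm.1 - weight e mm.2.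
  by move=> b; have [m [m' E]] := weight_diff (delta_mx 0 b); exists (m, m').
pose nu : 'rV[int]_d :=
  \row_b ((mnm_dot o (mm b).1)%:Z - (mnm_dot o (mm b).2)%:Z).
pose S := [set x : 'rV[int]_d | exists m m', x = weight e m - weight e m' /\
  pairing nu x = (mnm_dot o m)%:Z - (mnm_dot o m')%:Z].
have S0 : S 0.
  by exists mnm0, mnm0; rewrite !subrr pairing0r.
have SB x y : S x -> S y -> S (x - y).
  move=> [m [m' [-> nm]]] [p [p' [-> np]]].
  exists (mnm_add m p'), (mnm_add m' p); split.
    rewrite !weightD opprB opprD.
    by rewrite addrACA; congr (_ + _); rewrite addrC.
  rewrite pairingBr nm np !mnm_dotD !PoszD; ring.
have SN x : S x -> S (- x) by move=> Sx; rewrite -sub0r; apply: SB.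
have SD x y : S x -> S y -> S (x + y).
  by move=> Sx Sy; rewrite -[y]opprK; apply: SB => //; apply: SN.
have SMn x k : S x -> S (x *+ k).
  by move=> Sx; elim: k => // k IHk; rewrite mulrS; apply: SD.
have ST x : S x.
  rewrite [x]row_sum_delta; apply: (big_ind S) => // b _.
  have Sb : S (delta_mx 0 b).
    exists (mm b).1, (mm b).2; split=> //; rewrite /pairing (bigD1 b) //= big1.
      by rewrite !mxE !eqxx mulr1 addr0.
    by move=> c cb; rewrite [delta_mx _ _ _ _]mxE (negbTE cb) andbF mulr0.
  case: (x 0 b) => k; first by rewrite -[k%:Z]natz scaler_nat; apply: SMn.
  by rewrite NegzE scaleNr -[k.+1%:Z]natz scaler_nat; apply: SN; apply: SMn.
exists nu => i; have [m [m' [ei ->]]] := ST (e i).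
have /ow : weight e (mnm_add (mnm1 i) m') = weight e m.
  by rewrite weightD weightU {1}ei subrK.
by rewrite mnm_dotD mnm_dotU => <-; rewrite PoszD addrK.
Qed.

(** The orders of the coordinates of an arc in the torus respect the binomial
    relations, hence come from a lattice point. *)
Lemma arcs_star_order h : arcs_star R L e h -> exists (nu : 'rV[int]_d) o,
  [/\ forall i, pairing nu (e i) = (o i)%:Z, forall i, (0 < o i)%N &
      arcs_ord R L e nu h].
Proof.
move=> hs; have [/arcs_LP [h0 hb] hN0] := hs.
have /choice [o oP] : forall i, exists o, fps_order o (h i).
  by move=> i; apply: fps_neq0_order; have := hN0 (mnm1 i); rewrite mmap1U.
have /choice [v vP] : forall i, exists v : fps C,
    h i = fps_mon (o i) * v /\ fps_coef v 0 != 0.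
  by move=> i; have /fps_orderP [w hw w0] := oP i; exists w.
have hv i := (vP i).1; have v0 i := (vP i).2.
have hord m : fps_order (mnm_dot o m) (mmap1 h m).
  apply/fps_orderP; exists (mmap1 v m); first exact: mmap1_order.
  exact: mmap1_coef0.
have [nu nuo] : exists nu : 'rV[int]_d, forall i, pairing nu (e i) = (o i)%:Z.
  apply: dot_linear => m m' /hb mm'; apply: (fps_order_uniq (hord m)).
  by rewrite mm'.
exists nu, o; split=> // [i|].
  by rewrite lt0n; apply/eqP => oi; have [] := oP i; rewrite oi h0 eqxx.
by split=> // m; rewrite (pairing_weight _ nuo) has_orderE.
Qed.

End ArcsOfGivenOrder.

(** * Farkas' lemma and neighbourhoods *)

Section Farkas.
Variables (R : realType) (d : nat).
Implicit Types (x y b w : 'rV[R]_d) (s : seq 'rV[R]_d).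

Lemma pairing_self_ge0 x : 0 <= pairing x x.
Proof. by apply: sumr_ge0 => i _; rewrite -expr2 sqr_ge0. Qed.

Lemma pairing_self_gt0 x : x != 0 -> 0 < pairing x x.
Proof.
move=> x0; rewrite lt_neqAle pairing_self_ge0 andbT eq_sym.
apply: contra x0; rewrite psumr_eq0 => [/allP x0|i _]; last by rewrite -expr2 sqr_ge0.
apply/eqP/rowP => i; rewrite mxE; apply/eqP.
by have := x0 i (mem_index_enum _); rewrite mulf_eq0 orbb.
Qed.

Fixpoint conic s b : Prop :=
  if s is a :: s' then exists2 c, 0 <= c & conic s' (b - c *: a) else b = 0.

(** Turns a decomposition along sheared generators, as it comes from the
    induction in Farkas' lemma, into one along the generators themselves. *)
Lemma conic_shear a0 (f : 'rV[R]_d -> R) s b :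
    (forall a, a \in s -> 0 <= f a) ->
    conic [seq a + f a *: a0 | a <- s] b ->
  exists2 t, 0 <= t & conic s (b - t *: a0).
Proof.
elim: s b => [|a s IHs] b fge0 /=; first by move=> ->; exists 0; rewrite ?scale0r ?subrr.
move=> [c c0 /IHs [a' a's|t t0 st]]; first by rewrite fge0 // inE a's orbT.
exists (t + c * f a); first by rewrite addr_ge0 ?mulr_ge0 // fge0 // mem_head.
exists c => //; move: st; congr conic; apply/rowP => i; rewrite !mxE; ring.
Qed.

(** Farkas' lemma. When a vector [x0] that is nonnegative on [s] but not on [b]
    exists, it is negative on the first generator [a0]; shearing along [a0]
    turns every vector into one that [x0] kills, which removes [a0] from the
    system and lets the induction proceed. *)
Lemma farkas s b :
    (forall y, (forall a, a \in s -> 0 <= pairing y a) -> 0 <= pairing y b) ->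
  conic s b.
Proof.
have [m] := ubnP (size s); elim: m => // m IHm in s b *.
case: s => [|a0 s] /= sm H.
  apply/eqP/negPn/negP => /pairing_self_gt0 bb.
  have /H : forall a, a \in [::] -> 0 <= pairing (- b) a by [].
  by rewrite pairingNl oppr_ge0 leNgt bb.
case: (pselect (forall y, (forall a, a \in s -> 0 <= pairing y a) ->
                          0 <= pairing y b)) => [Hs|].
  by exists 0; rewrite ?scale0r ?subr0 //; apply: IHm.
move=> /existsNP [x1 /not_implyP [x1s /negP]]; rewrite -ltNge => x1b.
have x1a0 : pairing x1 a0 < 0.
  rewrite ltNge; apply/negP => x1a0; have /H : forall a,
      a \in a0 :: s -> 0 <= pairing x1 a.
    by move=> a; rewrite inE => /orP[/eqP -> //|]; apply: x1s.
  by rewrite leNgt x1b.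
have [x0 [x0a0 x0s x0b]] : exists x0, [/\ pairing x0 a0 = -1,
    forall a, a \in s -> 0 <= pairing x0 a & pairing x0 b < 0].
  have c_gt0 : 0 < (- pairing x1 a0)^-1 by rewrite invr_gt0 oppr_gt0.
  exists ((- pairing x1 a0)^-1 *: x1); split=> [|a /x1s xa|].
  - by rewrite pairingZl invrN mulNr mulVf // lt_eqF.
  - by rewrite pairingZl mulr_ge0 // ltW.
  - by rewrite pairingZl pmulr_rlt0.
have [|t t0 st] := @conic_shear a0 (pairing x0) s (b + pairing x0 b *: a0) x0s.
  apply: IHm => [|y ys]; first by rewrite size_map.
  have shearE a : pairing y (a + pairing x0 a *: a0) =
                  pairing (y + pairing y a0 *: x0) a.
    by rewrite pairingDr pairingDl pairingZr pairingZl mulrC.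
  rewrite shearE; apply: H => a; rewrite inE => /orP[/eqP ->|sa].
    by rewrite pairingDl pairingZl x0a0 mulrN1 subrr.
  by rewrite -shearE ys //; apply: map_f.
exists (t - pairing x0 b); first by lra.
move: st; congr conic; apply/rowP => i; rewrite !mxE; ring.
Qed.

End Farkas.

Section Topology.
Variables (R : realType) (d : nat).
Implicit Types (x y b w : 'rV[R]_d) (A : set 'rV[R]_d).

Lemma pairing_continuous w : continuous (fun x : 'rV[R]_d => pairing x w).
Proof.
rewrite /pairing; apply: continuous_big => [|i _ x].
  exact: add_continuous.
exact: (cvgMr_tmp (@coord_continuous R 1 d 0 i x)).
Qed.

Lemma near_pairing_gt x w c : c < pairing x w -> \forall y \near x, c < pairing y w.
Proof. by move=> cx; apply: (cvgr_gt _ (@pairing_continuous w x)). Qed.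

Lemma near_line x v (P : set 'rV[R]_d) : (\forall y \near x, P y) ->
  exists2 t : R, 0 < t & P (x + t *: v).
Proof.
move=> Px; have : (fun t : R => x + t *: v) @ 0^'+ --> x + 0 *: v.
  apply: cvgD; first exact: cvg_cst.
  by apply: cvgZr_tmp; apply: cvg_at_right_filter; exact: cvg_id.
rewrite scale0r addr0 => /(_ _ Px) Pt.
have [t [t0 xt]] : exists t : R, 0 < t /\ P (x + t *: v).
  apply: (@filter_ex _ (0 : R)^'+); apply: filterI => //.
  exact: nbhs_right_gt.
by exists t.
Qed.

(** The affine hull contains the line through [x] and [y], and near [x] this
    line is contained in [A]. *)
Lemma relint_extend A x y : relint A x -> A y ->
  exists2 t : R, 0 < t & A (x + t *: (x - y)).
Proof.
move=> [Ax nA] Ay; have [t t0 tA] := near_line (x - y) nA; exists t => //.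
apply: tA => B [BP AB].
have -> : x + t *: (x - y) = (1 - (- t)) *: x + (- t) *: y.
  by apply/rowP => i; rewrite !mxE; ring.
by apply: BP; apply: AB.
Qed.

End Topology.

(** * The cone and its dual *)

Section Cones.
Variables (R : realType) (d n : nat) (L : set 'rV[int]_d) (e : 'I_n -> 'rV[int]_d).
Hypothesis Le : smallest (@submonoid 'rV[int]_d) (range e) = L.
Local Notation toR := (@real_of_lattice R d).
Local Notation K := (sigma_dual R L).
Local Notation sg := (sigma R L).
Implicit Types (x y w nu : 'rV[R]_d).

Lemma real_of_latticeD u v : toR (u + v) = toR u + toR v.
Proof. by rewrite /real_of_lattice map_mxD. Qed.

Lemma real_of_lattice_sum (I : Type) (r : seq I) (P : pred I)
    (F : I -> 'rV[int]_d) :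
  toR (\sum_(i <- r | P i) F i) = \sum_(i <- r | P i) toR (F i).
Proof.
by apply: (big_morph toR real_of_latticeD); rewrite /real_of_lattice map_mx0.
Qed.

Lemma pairing_real_of_lattice (u v : 'rV[int]_d) :
  pairing (toR u) (toR v) = (pairing u v)%:~R.
Proof.
by rewrite /pairing raddf_sum; apply: eq_bigr => i _; rewrite !mxE -intrM.
Qed.

Lemma sigma_dualD x y : K x -> K y -> K (x + y).
Proof. by move=> Kx Ky B BP; apply: BP.1.1.2; [apply: Kx|apply: Ky]. Qed.

Lemma sigma_dualZ (c : R) x : 0 <= c -> K x -> K (c *: x).
Proof. by move=> c0 Kx B BP; apply: BP.1.2 => //; apply: Kx. Qed.

Lemma sigma_dual0 : K 0.
Proof. by move=> B BP; apply: BP.1.1.1. Qed.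

Lemma sigma_dual_sum (I : Type) (r : seq I) (P : pred I) (F : I -> 'rV[R]_d) :
  (forall i, P i -> K (F i)) -> K (\sum_(i <- r | P i) F i).
Proof. exact: (big_ind K sigma_dual0 sigma_dualD). Qed.

Lemma sigma_dual_gen i : K (toR (e i)).
Proof.
move=> B BP; apply: BP.2; exists (e i) => //; rewrite -Le => M [_]; apply.
by exists i.
Qed.

(** The finitely many [e i] replace the whole of [L] as generators. *)
Lemma sigma_dual_ind (Q : set 'rV[R]_d) :
    Q 0 -> (forall x y, Q x -> Q y -> Q (x + y)) ->
    (forall (c : R) x, 0 <= c -> Q x -> Q (c *: x)) ->
    (forall i, Q (toR (e i))) ->
  K `<=` Q.
Proof.
move=> Q0 QD QZ Qe x; apply; split=> // _ [u Lu <-].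
have : smallest (@submonoid 'rV[int]_d) (range e) u by rewrite Le.
move=> /(_ [set v | Q (toR v)]); apply; split=> [|_ [i _ <-] //=].
split=> [|a b /= Qa Qb]; first by rewrite /= /real_of_lattice map_mx0.
by rewrite real_of_latticeD; apply: QD.
Qed.

Lemma sigmaP nu : sg nu <-> forall i, 0 <= pairing nu (toR (e i)).
Proof.
split=> [snu i|nue w]; first by apply: snu; apply: sigma_dual_gen.
move: w; apply: sigma_dual_ind => //= [|x y|c x].
- by rewrite pairing0r.
- by rewrite pairingDr; apply: addr_ge0.
- by rewrite pairingZr; apply: mulr_ge0.
Qed.

Lemma conic_sigma_dual (s : seq 'rV[R]_d) b :
  (forall a, a \in s -> K a) -> conic s b -> K b.
Proof.
elim: s b => [|a s IHs] b sK /=; first by move=> ->; apply: sigma_dual0.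
move=> [c c0 /IHs Kb]; rewrite -(subrK (c *: a) b); apply: sigma_dualD.
  by apply: Kb => a' sa'; apply: sK; rewrite inE sa' orbT.
by apply: sigma_dualZ => //; apply: sK; rewrite mem_head.
Qed.

Lemma sigma_dual_farkas w : (forall nu, sg nu -> 0 <= pairing nu w) -> K w.
Proof.
move=> sw; apply: (@conic_sigma_dual [seq toR (e i) | i <- enum 'I_n]).
  by move=> _ /mapP[i _ ->]; apply: sigma_dual_gen.
apply: farkas => y ye; apply: sw; apply/sigmaP => i; apply: ye.
by apply/mapP; exists i; rewrite ?mem_enum.
Qed.

Lemma near_coord_lt x (r : R) : 0 < r ->
  \forall y \near x, forall j, `|(y : 'rV[R]_d) 0 j - x 0 j| < r.
Proof.
move=> r0.
apply: (@filter_forall _ _ (fun j y => `|y 0 j - x 0 j| < r) (nbhs x)) => j.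
have /cvgrPdist_lt/(_ _ r0) := @coord_continuous R 1 d 0 j x.
by move=> near_j; apply: filterS near_j => y /=; rewrite distrC.
Qed.

(** If every nonzero element of [sigma] were positive at [w], then by Farkas'
    lemma every vector would lie in the cone after adding a multiple of [w], and
    [w] would be interior. *)
Lemma sigma_dual_support w : K w -> ~ interior K w ->
  exists nu, [/\ sg nu, nu != 0 & pairing nu w = 0].
Proof.
move=> Kw niw; apply: contrapT => nex; apply: niw.
have pos nu : sg nu -> nu != 0 -> 0 < pairing nu w.
  move=> snu nu0; rewrite lt_neqAle (snu w Kw) andbT eq_sym.
  by apply/eqP => nuw; apply: nex; exists nu.
(* a decomposition of [v] along the [e i] and [- w] *)
have shift v : exists2 c : R, 0 <= c & K (v + c *: w).
  have [|c c0 cK] := @farkas R d (- w :: [seq toR (e i) | i <- enum 'I_n]) v.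
    move=> y yge; have sy : sg y.
      apply/sigmaP => i; apply: yge; rewrite inE; apply/orP; right.
      by apply/mapP; exists i; rewrite ?mem_enum.
    have [->|/(pos _ sy)] := eqVneq y 0; first by rewrite pairing0l.
    have := yge (- w); rewrite mem_head pairingNr => /(_ isT); lra.
  exists c => //; move: cK; rewrite scalerN opprK.
  apply: conic_sigma_dual => _ /mapP[i _ ->].
  exact: sigma_dual_gen.
have [c cP] : exists2 c : R, 0 < c & forall j : 'I_d,
    K (delta_mx 0 j + c *: w) /\ K (- delta_mx 0 j + c *: w).
  have /choice [f fP] : forall jb : 'I_d * bool, exists c : R, 0 <= c /\
      K ((-1) ^+ jb.2 *: delta_mx 0 jb.1 + c *: w).
    by move=> jb; have [c] := shift ((-1) ^+ jb.2 *: delta_mx 0 jb.1); exists c.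
  exists (1 + \sum_jb f jb).
    by rewrite ltr_pwDl // sumr_ge0 // => jb _; have [] := fP jb.
  have up (jb : 'I_d * bool) :
      K ((-1) ^+ jb.2 *: delta_mx 0 jb.1 + (1 + \sum_i f i) *: w).
    rewrite (bigD1 jb) //= addrCA scalerDl addrA; apply: sigma_dualD.
      by have [] := fP jb.
    apply: sigma_dualZ => //; rewrite addr_ge0 // sumr_ge0 // => i _.
    by have [] := fP i.
  move=> j; have := up (j, true); have := up (j, false).
  by rewrite /= expr0 expr1 scale1r scaleN1r.
move=> cK; have r0 : 0 < (c * d.+1%:R)^-1.
  by rewrite invr_gt0 mulr_gt0.
apply: filterS (near_coord_lt w r0) => y yw.
pose t j := y 0 j - w 0 j.
(* each coordinate of [y - w] is compensated by its share of [w] *)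
have -> : y = (1 - \sum_j c * `|t j|) *: w +
    \sum_j (t j *: delta_mx 0 j + (c * `|t j|) *: w).
  rewrite big_split /= -scaler_suml addrCA -scalerDl subrK scale1r.
  have -> : \sum_j t j *: delta_mx 0 j = y - w.
    by rewrite [RHS]row_sum_delta; apply: eq_bigr => j _; rewrite !mxE.
  by rewrite subrK.
apply: sigma_dualD.
  apply: sigma_dualZ => //; rewrite subr_ge0.
  apply: (@le_trans _ _ (\sum_(j < d) d.+1%:R^-1)).
    apply: ler_sum => j _; have := ltW (yw j).
    by rewrite invfM -ler_pdivlMl.
  rewrite sumr_const card_ord -[_ *+ d]mulr_natl ler_pdivrMr ?ltr0n // mul1r.
  by rewrite ler_nat.
apply: sigma_dual_sum => j _.
have -> : t j *: delta_mx 0 j + (c * `|t j|) *: w =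
    `|t j| *: (Num.sg (t j) *: delta_mx 0 j + c *: w).
  by rewrite scalerDr !scalerA (mulrC `|_| (Num.sg _)) -numEsg mulrC.
have [Kp Kn] := cK j; case: sgrP => tj.
- by rewrite scale0r; apply: sigma_dual0.
- by rewrite scale1r; apply: sigma_dualZ => //; apply: ltW.
- by rewrite scaleN1r; apply: sigma_dualZ => //; rewrite oppr_ge0 ltW.
Qed.

Lemma interior_pairing_gt0 w nu :
  interior K w -> sg nu -> nu != 0 -> 0 < pairing nu w.
Proof.
move=> iw snu nu0; have [t t0 Kt] := near_line (- nu) iw.
have := snu _ Kt; rewrite pairingDr pairingZr pairingNr.
have := mulr_gt0 t0 (pairing_self_gt0 nu0); lra.
Qed.

Hypothesis e_neq0 : forall i, e i != 0.
Hypothesis K_strict : strictly_convex K.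

(** Strict convexity provides for each [i] an element of [sigma] positive at
    [e i]; a relative interior point at which [e i] vanished could be moved
    slightly away from it, and would become negative at [e i]. *)
Lemma relint_sigmaP nu : relint sg nu <-> forall i, 0 < pairing nu (toR (e i)).
Proof.
split=> [rnu i|nu_gt0]; last first.
  split; first by apply/sigmaP => i; apply: ltW.
  have : \forall y \near nu, forall i, 0 < pairing y (toR (e i)).
    apply: (@filter_forall _ _ (fun i y => 0 < pairing y (toR (e i))) (nbhs nu)).
    by move=> i; apply: near_pairing_gt.
  by apply: filterS => y y0 _; apply/sigmaP => i; apply: ltW.
have [nu1 snu1 nu1i] : exists2 nu1, sg nu1 & 0 < pairing nu1 (toR (e i)).
  apply: contrapT => nex; have Ke : K (- toR (e i)).
    apply: sigma_dual_farkas => nu1 snu1; rewrite pairingNr oppr_ge0 leNgt.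
    by apply/negP => nu1i; apply: nex; exists nu1.
  have : (K `&` [set x | K (- x)]) (toR (e i)).
    by split=> //; apply: sigma_dual_gen.
  rewrite K_strict => /= ei0; have /eqP := e_neq0 i; apply; apply/rowP => j.
  by move/rowP/(_ j): ei0; rewrite !mxE => /eqP; rewrite intr_eq0 => /eqP.
have nui : 0 <= pairing nu (toR (e i)) by move/sigmaP: rnu.1.
have [t t0 /sigmaP /(_ i)] := relint_extend rnu snu1.
rewrite pairingDl pairingZl pairingBl => tge; rewrite lt_neqAle nui andbT eq_sym.
by apply/eqP => nu0; have := mulr_gt0 t0 nu1i; rewrite nu0 in tge; lra.
Qed.

Lemma pairing_gt0 nu w : (forall i, 0 < pairing nu (toR (e i))) ->
  K w -> w != 0 -> 0 < pairing nu w.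
Proof.
move=> nu_gt0; move: w; suff : K `<=` [set w | w = 0 \/ 0 < pairing nu w].
  by move=> Kpos w /Kpos [->|//]; rewrite eqxx.
apply: sigma_dual_ind => /= [|x y|c x c0|i]; first by left.
- move=> [->|x0] [->|y0]; rewrite ?addr0 ?add0r; [by left|by right..|].
  by right; rewrite pairingDr addr_gt0.
- move=> [->|x0]; first by left; rewrite scaler0.
  move: c0; rewrite le_eqVlt => /orP[/eqP <-|c0].
    by left; rewrite scale0r.
  by right; rewrite pairingZr mulr_gt0.
- by right.
Qed.

End Cones.

(** A zero generator could be left out. *)
Lemma minimal_generators_neq0 d n (e : 'I_n -> 'rV[int]_d) L i :
  minimal_generators e L -> e i != 0.
Proof.
move=> [Le Lmin]; apply/eqP => ei.
suff /Lmin /setP /(_ i) : smallest (@submonoid 'rV[int]_d)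
    (e @` [set j | j \in [set~ i]%SET]) = L by rewrite !inE eqxx.
rewrite -Le; apply/seteqP; split=> x Sx M [Msub Me]; apply: Sx; split=> //.
  by move=> _ [j _ <-]; apply: Me; exists j.
move=> _ [j _ <-]; have [->|ji] := eqVneq j i; first by rewrite ei; apply: Msub.1.
by apply: Me; exists j => //=; rewrite !inE.
Qed.

(** * Independent sets of generators *)

Section IndependentSets.
Variables (R : realType) (d n : nat) (e : 'I_n -> 'rV[int]_d).
Local Notation toR := (@real_of_lattice R d).
Implicit Types (B I : {set 'I_n}) (i : 'I_n).

Definition gen_span B : 'M[R]_d := (\sum_(i in B) <<toR (e i)>>)%MS.
Definition gen_rank B := \rank (gen_span B).
Definition indep B := gen_rank B == #|B|.

Lemma gen_span_sub B i : i \in B -> (toR (e i) <= gen_span B)%MS.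
Proof. by move=> iB; rewrite (sumsmx_sup i) // genmxE. Qed.

Lemma gen_span_subP m (M : 'M[R]_(m, d)) B :
  reflect (forall i, i \in B -> (toR (e i) <= M)%MS) (gen_span B <= M)%MS.
Proof.
apply: (iffP sumsmx_subP) => BM i iB; first by have := BM i iB; rewrite genmxE.
by rewrite genmxE BM.
Qed.

Lemma gen_spanS B I : B \subset I -> (gen_span B <= gen_span I)%MS.
Proof.
by move=> /fintype.subsetP BI; apply/gen_span_subP => i /BI; apply: gen_span_sub.
Qed.

Lemma gen_spanU1 i B :
  (gen_span (i |: B) :=: gen_span B + <<toR (e i)>>)%MS.
Proof.
apply/eqmxP/andP; split.
  apply/gen_span_subP => j /finset.setU1P[->|jB].
    by apply: submx_trans (addsmxSr _ _); rewrite genmxE.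
  by apply: submx_trans (addsmxSl _ _); apply: gen_span_sub.
rewrite addsmx_sub genmxE gen_spanS ?finset.subsetUr //.
by rewrite gen_span_sub // finset.setU11.
Qed.

Lemma gen_rankU1 i B : (gen_rank (i |: B) <= (gen_rank B).+1)%N.
Proof.
rewrite /gen_rank gen_spanU1; apply: leq_trans (mxrank_adds_leqif _ _) _.
by rewrite -[(gen_rank B).+1]addn1 leq_add2l mxrank_gen rank_leq_row.
Qed.

Lemma gen_rank_card B : (gen_rank B <= #|B|)%N.
Proof.
have [m] := ubnP #|B|; elim: m => // m IHm in B *.
have [->|[i iB]] := finset.set_0Vmem B.
  by rewrite /gen_rank /gen_span big_set0 mxrank0.
rewrite (cardsD1 i) iB ltnS => /IHm le; rewrite -{1}(finset.setD1K iB).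
exact: leq_trans (gen_rankU1 _ _) _.
Qed.

Lemma indepD1 B b : indep B -> b \in B -> indep (B :\ b).
Proof.
move=> /eqP iB bB; rewrite /indep eqn_leq gen_rank_card /=.
by rewrite -ltnS -[#|_|.+1]add1n -{1}[1%N]/(true : nat) -bB -cardsD1 -iB
           -{1}(finset.setD1K bB) gen_rankU1.
Qed.

Lemma gen_rankU1_notin B i : ~~ (toR (e i) <= gen_span B)%MS ->
  (gen_rank B < gen_rank (i |: B))%N.
Proof.
move=> ni; rewrite ltnNge; apply: contra ni => le.
have sub := gen_spanS (finset.subsetUr [set i]%SET B).
have := mxrank_leqif_sup sub => -[_].
rewrite eqn_leq mxrankS //= le => /esym iB; apply: submx_trans iB.
by rewrite gen_span_sub // finset.setU11.
Qed.

Lemma indepU1 B i : indep B -> ~~ (toR (e i) <= gen_span B)%MS ->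
  indep (i |: B) /\ i \notin B.
Proof.
move=> /eqP iB ni; have niB : i \notin B by apply: contra ni; apply: gen_span_sub.
split=> //; rewrite /indep eqn_leq gen_rank_card cardsU1 niB add1n -iB.
exact: gen_rankU1_notin.
Qed.

(** The exchange property of the matroid of the generators. *)
Lemma gen_rank_exchange B I : (gen_rank B < gen_rank I)%N ->
  exists2 i, i \in I & ~~ (toR (e i) <= gen_span B)%MS.
Proof.
move=> BI; apply/exists_inP; apply: contraLR BI => /exists_inPn sub.
rewrite -leqNgt; apply/mxrankS/gen_span_subP => i iI.
by apply/negPn/sub.
Qed.

Lemma gen_span_eq B I : B \subset I -> gen_rank B = gen_rank I ->
  forall i, i \in I -> (toR (e i) <= gen_span B)%MS.
Proof.
move=> BI rBI i /gen_span_sub iI; apply: submx_trans iI _.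
by rewrite -(mxrank_leqif_sup (gen_spanS BI)).2; apply/eqP.
Qed.

Lemma indep_exists k I : (k <= gen_rank I)%N ->
  exists B, [/\ B \subset I, #|B| = k & indep B].
Proof.
elim: k => [|k IHk] kI.
  exists finset.set0; rewrite finset.sub0set cards0 /indep cards0.
  by rewrite /gen_rank /gen_span big_set0 mxrank0.
have [B [BI Bk iB]] := IHk (ltnW kI).
have [|i iI ni] := @gen_rank_exchange B I; first by rewrite (eqP iB) Bk.
have [iiB niB] := indepU1 iB ni; exists (i |: B); split=> //.
  by rewrite finset.subUset finset.sub1set iI.
by rewrite cardsU1 niB Bk.
Qed.

Lemma enum_val_homo (A : {set 'I_n}) :
  {homo (@enum_val _ (mem A)) : a b / (a < b)%N}.
Proof.
move=> a b ab; rewrite /enum_val.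
have x0 := enum_val a.
rewrite !(set_nth_default x0) -?cardE ?ltn_ord //.
have sA : sorted ltn [seq val i | i <- enum (mem A)].
  apply: (subseq_sorted ltn_trans (_ : subseq _ (iota 0 n))); last first.
    exact: iota_ltn_sorted.
  by rewrite -val_enum_ord map_subseq // enumT /= filter_subseq.
have := sorted_ltn_nth ltn_trans (val x0) sA.
move=> /(_ a b); rewrite !inE !size_map -!cardE !ltn_ord => /(_ isT isT ab).
by rewrite !(nth_map x0) -?cardE.
Qed.

(** The coordinates of the exterior product are the maximal minors. *)
Lemma wedge_neq0 k (f : 'I_k -> 'I_n) :
  (wedge (e \o f) != 0) = row_free (\matrix_a toR (e (f a))).
Proof.
set M := \matrix_a _.
have minorE g : (wedge (e \o f) g)%:~R = \det (colsub g M).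
  rewrite ffunE -det_map_mx; congr (\det _).
  by apply/matrixP => a b; rewrite !mxE.
apply/idP/idP => [w0|rM].
  have /existsP [g gw] : [exists g, wedge (e \o f) g != 0].
    apply: contraR w0 => /existsPn w0; apply/eqP/ffunP => g.
    by rewrite [RHS]ffunE; apply/eqP/negPn/w0.
  have : colsub g M \in unitmx.
    by rewrite unitmxE -minorE unitfE intr_eq0.
  rewrite -row_free_unit -!row_leq_rank => kr; apply: leq_trans kr _.
  by rewrite -{1}[M]mulmx1 -mulmx_colsub mxrankM_maxl.
have fM : row_full M^T by rewrite /row_full mxrank_tr.
have uM := fullrowsub_unit fM; set g := fullrankfun fM in uM.
apply: contraL uM => /eqP w0; rewrite -unitmx_tr trmx_mxsub trmxK.
rewrite (_ : colsub g M = colsub (finfun g) M); last first.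
  by apply/matrixP => a b; rewrite !mxE ffunE.
by rewrite unitmxE -minorE w0 ffunE unitr0.
Qed.

(** Increasing families are traded for subsets of the index set, whose elements
    can be exchanged one at a time. *)
Lemma JsetP k u : Jset e k u <->
  exists B, [/\ #|B| = k, indep B & u = \sum_(i in B) e i].
Proof.
have rank_rows j (f : 'I_j -> 'I_n) :
    \rank (\matrix_a toR (e (f a))) = gen_rank (f @: 'I_j).
  apply/eqmx_rank/andP; split.
    by apply/row_subP => a; rewrite rowK gen_span_sub // imset_f.
  apply/gen_span_subP => _ /imsetP[a _ ->]; rewrite -(rowK (fun a => toR (e (f a))) a).
  exact: row_sub.
split=> [[f [f_homo]]|[B [<- iB ->]]].
  have f_inj : injective f.
    move=> a b fab; case: (ltngtP a b) => [/f_homo|/f_homo|/val_inj //];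
      by rewrite fab ltnn.
  rewrite wedge_neq0 /row_free rank_rows => rf ->; exists (f @: 'I_k).
  have cf : #|f @: 'I_k| = k by rewrite card_imset // card_ord.
  split=> //; first by rewrite /indep cf.
  by rewrite big_imset //= => a b _ _; apply: f_inj.
exists (@enum_val _ (mem B)); split; first exact: enum_val_homo.
  rewrite wedge_neq0 /row_free rank_rows (_ : _ @: _ = B) //.
  apply/setP => i; apply/imsetP/idP => [[a _ ->]|iB']; first exact: enum_valP.
  by exists (enum_rank_in iB' i) => //; rewrite enum_rankK_in.
exact: big_enum_val.
Qed.

Hypothesis e_generates : smallest (@subgroup 'rV[int]_d)
  (smallest (@submonoid 'rV[int]_d) (range e)) = setT.

(** The linear span of the [e i] contains the lattice that they generate. *)
Lemma gen_rankT : gen_rank [set: 'I_n] = d.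
Proof.
have all_in u : (toR u <= gen_span [set: 'I_n])%MS.
  have : smallest (@subgroup 'rV[int]_d)
      (smallest (@submonoid 'rV[int]_d) (range e)) u by rewrite e_generates.
  move=> /(_ [set u | toR u <= gen_span [set: 'I_n]]%MS); apply; split.
    split=> [|x y /= xT yT]; rewrite /= /real_of_lattice ?map_mx0 ?sub0mx //.
    by rewrite map_mxB addmx_sub // eqmx_opp.
  move=> x /(_ [set u | toR u <= gen_span [set: 'I_n]]%MS); apply; split.
    split=> [|{}x y /= xT yT]; rewrite /= ?real_of_latticeD ?addmx_sub //.
    by rewrite /real_of_lattice map_mx0 sub0mx.
  by move=> _ [i _ <-]; apply: gen_span_sub; rewrite inE.
apply/eqP; rewrite eqn_leq rank_leq_col -{1}(mxrank1 R d) mxrankS //.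
apply/row_subP => b; rewrite rowE mulmx1.
by have := all_in (delta_mx 0 b); rewrite /real_of_lattice map_delta_mx.
Qed.

End IndependentSets.

(** * Minimal sets and the functions ord of the Newton polyhedra *)

Section Newton.
Variables (R : realType) (d n : nat) (L : set 'rV[int]_d) (e : 'I_n -> 'rV[int]_d).
Hypothesis Le : smallest (@submonoid 'rV[int]_d) (range e) = L.
Hypothesis d_gt0 : (0 < d)%N.
Hypothesis L_generates : smallest (@subgroup 'rV[int]_d) L = setT.
Local Notation toR := (@real_of_lattice R d).
Local Notation K := (sigma_dual R L).
Local Notation sg := (sigma R L).
Local Notation indep := (indep R e).
Local Notation gen_rank := (gen_rank R e).
Local Notation gen_span := (gen_span R e).
Implicit Types (x y w nu : 'rV[R]_d) (B I : {set 'I_n}).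

Definition vertex B : 'rV[R]_d := toR (\sum_(i in B) e i).

Definition wt nu B : R := \sum_(i in B) pairing nu (toR (e i)).

Lemma pairing_vertex nu B : pairing nu (vertex B) = wt nu B.
Proof. by rewrite /vertex real_of_lattice_sum pairing_sumr. Qed.

Lemma wtD1 nu B b : b \in B ->
  wt nu B = pairing nu (toR (e b)) + wt nu (B :\ b).
Proof. by move=> bB; rewrite /wt (big_setD1 b). Qed.

Lemma wtU1 nu B i : i \notin B ->
  wt nu (i |: B) = pairing nu (toR (e i)) + wt nu B.
Proof. by move=> iB; rewrite /wt big_setU1. Qed.

Definition segment_closed (Q : set 'rV[R]_d) :=
  forall (t : R) x y, 0 <= t <= 1 -> Q x -> Q y -> Q (t *: x + (1 - t) *: y).

Lemma newton_ind k (Q : set 'rV[R]_d) : segment_closed Q ->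
    (forall B w, #|B| = k -> indep B -> K w -> Q (vertex B + w)) ->
  newton L e k `<=` Q.
Proof.
move=> Qc Qg x; apply; split.
  move=> a b t; rewrite !inE => Qa Qb; apply: Qc => //.
  by rewrite ge0 le1.
by move=> _ [_ [w [/(JsetP R) [B [Bk iB ->]] Kw ->]]]; apply: Qg.
Qed.

Lemma newton_vertex k B w : #|B| = k -> indep B -> K w ->
  newton L e k (vertex B + w).
Proof.
move=> Bk iB Kw Q [_ Qg]; apply: Qg; exists (\sum_(i in B) e i), w; split=> //.
by apply/(JsetP R); exists B.
Qed.

Lemma halfspace_segment_closed nu c : segment_closed [set x | c <= pairing nu x].
Proof.
move=> t x y /andP[t0 t1] /= cx cy; rewrite pairingDr !pairingZr.
have -> : c = t * c + (1 - t) * c by ring.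
by apply: lerD; apply: ler_wpM2l; rewrite ?subr_ge0.
Qed.

Lemma newton_ge nu k c : sg nu ->
    (forall B, #|B| = k -> indep B -> c <= wt nu B) ->
  forall x, newton L e k x -> c <= pairing nu x.
Proof.
move=> snu cB; apply: newton_ind; first exact: halfspace_segment_closed.
move=> B w Bk iB Kw /=; rewrite pairingDr pairing_vertex -[c]addr0.
by apply: lerD; [apply: cB|apply: snu].
Qed.

Lemma newton_ge0 nu k x : sg nu -> newton L e k x -> 0 <= pairing nu x.
Proof.
move=> snu; apply: newton_ge => // B _ _; apply: sumr_ge0 => i _.
by move/(sigmaP Le): snu.
Qed.

Lemma ordJ_le nu k x : sg nu -> newton L e k x -> ordJ L e k nu <= pairing nu x.
Proof.
move=> snu kx; apply: ge_inf; last by exists x.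
by exists 0 => _ [y ky <-]; apply: newton_ge0 ky.
Qed.

Lemma ordJ_le_wt nu k B : sg nu -> #|B| = k -> indep B ->
  ordJ L e k nu <= wt nu B.
Proof.
move=> snu Bk iB; rewrite -pairing_vertex -[vertex B]addr0.
by apply: ordJ_le => //; apply: newton_vertex => //; apply: sigma_dual0.
Qed.

Definition min_set nu k B := [/\ #|B| = k, indep B & wt nu B = ordJ L e k nu].

Lemma gen_rankT_L : gen_rank [set: 'I_n] = d.
Proof. by apply: gen_rankT; rewrite Le. Qed.

Lemma min_set_exists nu k : sg nu -> (k <= d)%N -> exists B, min_set nu k B.
Proof.
move=> snu kd.
have [|B0 [_ Bk iB]] := @indep_exists R d n e k [set: 'I_n].
  by rewrite gen_rankT_L.
pose P B := (#|B| == k) && indep B.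
have PB0 : P B0 by rewrite /P Bk eqxx.
have [B /andP[/eqP Bk' iB'] Bmin] := arg_minP (fun B => wt nu B) PB0.
exists B; split=> //; apply/eqP; rewrite eq_le ordJ_le_wt // andbT.
apply: lb_le_inf.
  exists (pairing nu (vertex B + 0)), (vertex B + 0) => //.
  by apply: newton_vertex => //; apply: sigma_dual0.
move=> _ [x kx <-]; apply: newton_ge kx => // B1 B1k iB1.
by apply: Bmin; rewrite /P B1k eqxx.
Qed.

Lemma min_set_face nu k B : min_set nu k B -> face_of L e k nu (vertex B).
Proof.
move=> [Bk iB BE]; split; last by rewrite pairing_vertex.
by rewrite -[vertex B]addr0; apply: newton_vertex => //; apply: sigma_dual0.
Qed.

Lemma ordJ0 nu : sg nu -> ordJ L e 0 nu = 0.
Proof.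
move=> /min_set_exists /(_ (leq0n d)) [B [/eqP]]; rewrite cards_eq0 => /eqP -> _.
by rewrite /wt big_set0.
Qed.

Definition low nu (s : R) : {set 'I_n} := [set i | pairing nu (toR (e i)) <= s]%SET.

(** Adding to a minimal set a generator of value at most [s]. *)
Lemma ordJ_diff_le nu s j : sg nu -> (j < gen_rank (low nu s))%N ->
  ordJ L e j.+1 nu - ordJ L e j nu <= s.
Proof.
move=> snu js; have jd : (j < d)%N by apply: leq_trans js (rank_leq_col _).
have [B [Bj iB BE]] := min_set_exists snu (ltnW jd).
have [|i il ni] := @gen_rank_exchange R d n e B (low nu s).
  by rewrite (eqP iB) Bj.
have [iiB niB] := indepU1 iB ni.
have : ordJ L e j.+1 nu <= wt nu (i |: B).
  by apply: ordJ_le_wt; rewrite // cardsU1 niB Bj.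
by move: il; rewrite wtU1 // BE inE; lra.
Qed.

(** Removing from a minimal set an element of value larger than [s]. *)
Lemma ordJ_diff_gt nu s j : sg nu -> (gen_rank (low nu s) <= j < d)%N ->
  s < ordJ L e j.+1 nu - ordJ L e j nu.
Proof.
move=> snu /andP[sj jd]; have [B [Bj iB BE]] := min_set_exists snu jd.
have [b bB bl] : exists2 b, b \in B & b \notin low nu s.
  apply/exists_inP; apply: contraT => /exists_inPn Bl.
  have : (gen_rank B <= gen_rank (low nu s))%N.
    by apply/mxrankS/gen_spanS/fintype.subsetP => b /Bl /negPn.
  by rewrite (eqP iB) Bj => /leq_trans /(_ sj); rewrite ltnn.
have : ordJ L e j nu <= wt nu (B :\ b).
  apply: ordJ_le_wt; rewrite ?indepD1 //.
  by move: Bj; rewrite (cardsD1 b) bB => -[].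
by move: bl; rewrite -BE (wtD1 _ bB) inE -ltNge; lra.
Qed.

(** Exchanging an element of value larger than [s] for a generator of value at
    most [s] would decrease the weight. *)
Lemma min_set_low nu s j B : sg nu -> min_set nu j B ->
  (j <= gen_rank (low nu s))%N -> B \subset low nu s.
Proof.
move=> snu [Bj iB BE] js; apply/fintype.subsetP => b bB.
apply/negPn/negP => bl.
have [|i il ni] := @gen_rank_exchange R d n e (B :\ b) (low nu s).
  apply: leq_trans js; rewrite (eqP (indepD1 iB bB)) -Bj.
  by rewrite [X in (_ < X)%N](cardsD1 b) bB.
have [iiB niB] := indepU1 (indepD1 iB bB) ni.
have : ordJ L e j nu <= wt nu (i |: (B :\ b)).
  apply: ordJ_le_wt => //; rewrite cardsU1 niB -Bj [RHS](cardsD1 b) bB //.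
rewrite wtU1 // -BE (wtD1 _ bB); move: il bl; rewrite !inE -ltNge; lra.
Qed.

(** By the two exchanges above, phi_k(nu) is the value at [nu] of the [k]-th
    element picked by the greedy algorithm, and the elements picked of value at
    most [s] form a basis of the span of the generators of value at most [s]. *)
Lemma phi_le nu s k : sg nu -> (0 < k)%N ->
  (phi L e k nu <= s%:E)%E = (k <= gen_rank (low nu s))%N.
Proof.
move=> snu; case: k => // k _; rewrite /phi.
have [kd|dk] := ltnP k d; last first.
  rewrite [RHS](_ : _ = false); last first.
    by apply/negbTE; rewrite -ltnNge ltnS (leq_trans (rank_leq_col _)).
  case: k dk => [|k] dk; last by rewrite /= leye_eq.

  by move: d_gt0; rewrite ltnNge dk.
have -> : (if k.+1 == 1%N then (ordJ L e 1 nu)%:E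
    else (ordJ L e k.+1 nu - ordJ L e k nu)%:E) =
    (ordJ L e k.+1 nu - ordJ L e k nu)%:E.
  by case: k {kd} => //=; rewrite ordJ0 // subr0.
rewrite lee_fin; have [ks|sk] := ltnP k; first exact: ordJ_diff_le.
by apply/negbTE; rewrite -ltNge ordJ_diff_gt // sk.
Qed.

Lemma Aset_rank k (nu : 'rV[int]_d) (s : nat) : (0 < k)%N -> (0 < s)%N ->
  relint sg (toR nu) ->
  @Aset R _ _ L e k (nu, s) <-> k = gen_rank (low (toR nu) s%:R).
Proof.
move=> k0 s0 rnu; have snu := rnu.1.
rewrite /Aset /= ltNge !phi_le // -ltnNge; split=> [[_ _ ks sk]|->].
  by apply/eqP; rewrite eqn_leq ks -ltnS.
by split.
Qed.

End Newton.

(** * Faces, truncated values and fans *)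

Section Faces.
Variables (R : realType) (d n : nat) (L : set 'rV[int]_d) (e : 'I_n -> 'rV[int]_d).
Hypothesis Le : smallest (@submonoid 'rV[int]_d) (range e) = L.
Hypothesis L_generates : smallest (@subgroup 'rV[int]_d) L = setT.
Local Notation toR := (@real_of_lattice R d).
Local Notation K := (sigma_dual R L).
Local Notation sg := (sigma R L).
Local Notation indep := (indep R e).
Local Notation gen_rank := (gen_rank R e).
Local Notation gen_span := (gen_span R e).
Local Notation low := (low e).
Local Notation vertex := (vertex R e).
Local Notation wt := (wt e).
Local Notation min_set := (min_set L e).
Implicit Types (x y w nu : 'rV[R]_d) (B I : {set 'I_n}).

Local Notation positive nu := (forall i, 0 < pairing nu (toR (e i))).

Let positive_sigma nu : positive nu -> sg nu.
Proof. by move=> nup; apply/(sigmaP Le) => i; apply: ltW. Qed.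

Let average_min (t a b m : R) : 0 < t -> 0 < 1 - t -> m <= a -> m <= b ->
  t * a + (1 - t) * b = m -> a = m /\ b = m.
Proof.
move=> t0 t1 ma mb E.
have h1 : 0 <= t * (a - m) by apply: mulr_ge0; [exact: ltW|rewrite subr_ge0].
have h2 : 0 <= (1 - t) * (b - m) by apply: mulr_ge0; [exact: ltW|rewrite subr_ge0].
have h : t * (a - m) + (1 - t) * (b - m) = 0.
  have -> : t * (a - m) + (1 - t) * (b - m) = t * a + (1 - t) * b - m by ring.
  by rewrite E subrr.
have /eqP := h; rewrite paddr_eq0 // !mulf_eq0 (gt_eqF t0) (gt_eqF t1) /= !subr_eq0.
by move=> /andP[/eqP -> /eqP ->].
Qed.

(** The condition which is inherited along segments is to lie in [Q] as soon as
    the minimum is attained. A generator [vertex B + w] attains it only for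
    [w] zero and [B] minimal, because [nu] is positive on the cone. *)
Lemma face_ind nu k (Q : set 'rV[R]_d) : positive nu -> segment_closed Q ->
    (forall B, min_set nu k B -> Q (vertex B)) ->
  face_of L e k nu `<=` Q.
Proof.
move=> nup Qc Qm x [kx xE]; have snu := positive_sigma nup.
suff : newton L e k `<=` [set y | ordJ L e k nu <= pairing nu y /\
    (pairing nu y = ordJ L e k nu -> Q y)].
  by move=> /(_ _ kx) [_]; apply.
apply: newton_ind => [t y z /andP[t0 t1] [yge yQ] [zge zQ]|B w Bk iB Kw].
  split; first by apply: halfspace_segment_closed; rewrite // t0.
  rewrite pairingDr !pairingZr => tE.
  have [t00|tn0] := eqVneq t 0.
    by rewrite t00 scale0r add0r subr0 scale1r; apply: zQ; rewrite -tE t00; ring.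
  have [t11|tn1] := eqVneq t 1.
    by rewrite t11 subrr scale0r addr0 scale1r; apply: yQ; rewrite -tE t11; ring.
  have tp : 0 < t by rewrite lt_neqAle eq_sym tn0.
  have tp1 : 0 < 1 - t by rewrite subr_gt0 lt_neqAle tn1.
  have [yE zE] := average_min tp tp1 yge zge tE.
  by apply: Qc; rewrite ?t0 //; [apply: yQ|apply: zQ].
rewrite /= pairingDr pairing_vertex.
have wtB := ordJ_le_wt Le snu Bk iB; have wge := snu _ Kw.
split=> [|/eqP]; first lra.
have [->|w0] := eqVneq w 0.
  by rewrite pairing0r !addr0 => /eqP BE; apply: Qm.
have := pairing_gt0 Le nup Kw w0; lra.
Qed.

Lemma hyperplane_segment_closed nu c : segment_closed [set x | pairing nu x = c].
Proof.
by move=> t x y _ /= cx cy; rewrite pairingDr !pairingZr cx cy; ring.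
Qed.

Lemma open_halfspace_segment_closed nu c :
  segment_closed [set x | c < pairing nu x].
Proof.
move=> t x y /andP[t0 t1] /= cx cy; rewrite pairingDr !pairingZr.
have -> : c = t * c + (1 - t) * c by ring.
move: t0; rewrite le_eqVlt => /orP[/eqP <-|t0].
  by rewrite subr0 !mul0r !mul1r !add0r.
by apply: ltr_leD; [rewrite ltr_pM2l|rewrite ler_wpM2l ?subr_ge0 // ltW].
Qed.

Lemma pairing_gen_span x u B : (forall b, b \in B -> pairing x (toR (e b)) = 0) ->
  (u <= gen_span B)%MS -> pairing x u = 0.
Proof.
move=> xB /submx_trans; pose M := kermx x^T.
have pE v : (v *m x^T) 0 0 = pairing x v.
  by rewrite !mxE; apply: eq_bigr => i _; rewrite !mxE mulrC.
move=> /(_ _ M) -/(_ _) uM; have : (u <= M)%MS.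
  apply: uM; apply/gen_span_subP => b /xB bx; apply/sub_kermxP/matrixP => i j.
  by rewrite !ord1 pE bx mxE.
by move/sub_kermxP => ux; rewrite -pE ux mxE.
Qed.

Lemma vertex_kill nu B : sg nu -> pairing nu (vertex B) = 0 ->
  forall b, b \in B -> pairing nu (toR (e b)) = 0.
Proof.
move=> /(sigmaP Le) snu; rewrite pairing_vertex => /eqP.
rewrite psumr_eq0 => [/allP B0 b bB|i _ //].
by apply/eqP; apply: (implyP (B0 b _)); rewrite // mem_index_enum.
Qed.

(** Agreement as soon as one of the two values is at most [s] is equality of the
    values truncated beyond [s]. *)
Definition trunc_eq s nu nu' := forall i,
  (pairing nu (toR (e i)) <= s) || (pairing nu' (toR (e i)) <= s) ->
  pairing nu (toR (e i)) = pairing nu' (toR (e i)).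

Lemma trunc_eq_sym s nu nu' : trunc_eq s nu nu' -> trunc_eq s nu' nu.
Proof. by move=> T i; rewrite orbC => /T. Qed.

Lemma trunc_eq_low s nu nu' : trunc_eq s nu nu' -> low nu s = low nu' s.
Proof.
move=> T; apply/setP => i; rewrite !inE; apply/idP/idP => il.
  by rewrite -T // il.
by rewrite T // il orbT.
Qed.

Lemma trunc_eq_wt s nu nu' B : trunc_eq s nu nu' -> B \subset low nu s ->
  wt nu B = wt nu' B.
Proof.
move=> T /fintype.subsetP Bl; apply: eq_bigr => i /Bl; rewrite inE => il.
by apply: T; rewrite il.
Qed.

(** The minimal sets of size at most the rank of [low nu s] consist of elements
    of [low nu s], whose values are not truncated. *)
Lemma trunc_eq_ordJ_le s nu nu' j : sg nu -> sg nu' -> trunc_eq s nu nu' ->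
  (j <= gen_rank (low nu s))%N -> ordJ L e j nu' <= ordJ L e j nu.
Proof.
move=> snu snu' T js; have jd : (j <= d)%N by apply: leq_trans js (rank_leq_col _).
have [B mB] := min_set_exists Le L_generates snu jd.
have [Bj iB <-] := mB; rewrite (trunc_eq_wt T (min_set_low Le snu mB js)).
exact: ordJ_le_wt.
Qed.

Lemma trunc_eq_ordJ s nu nu' j : sg nu -> sg nu' -> trunc_eq s nu nu' ->
  (j <= gen_rank (low nu s))%N -> ordJ L e j nu = ordJ L e j nu'.
Proof.
move=> snu snu' T js; apply/eqP; rewrite eq_le (trunc_eq_ordJ_le snu snu' T) // andbT.
apply: trunc_eq_ordJ_le (trunc_eq_sym T) _ => //.
by rewrite -(trunc_eq_low T).
Qed.

Lemma trunc_eq_face_sub s nu nu' j : positive nu -> sg nu' -> trunc_eq s nu nu' ->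
  (j <= gen_rank (low nu s))%N -> face_of L e j nu `<=` face_of L e j nu'.
Proof.
move=> nup snu' T js x xF; split; first exact: xF.1.
have snu := positive_sigma nup; move: x xF; apply: face_ind => //.
  exact: hyperplane_segment_closed.
move=> B mB; rewrite /= pairing_vertex -(trunc_eq_ordJ snu snu' T js).
have [_ _ <-] := mB; apply/esym/(trunc_eq_wt T).
exact: (min_set_low Le snu mB js).
Qed.

Lemma trunc_eq_face s nu nu' j : positive nu -> positive nu' ->
    trunc_eq s nu nu' -> (j <= gen_rank (low nu s))%N ->
  face_of L e j nu = face_of L e j nu'.
Proof.
move=> nup nup' T js; apply/seteqP; split.
  by apply: trunc_eq_face_sub T js => //; apply: positive_sigma.
apply: trunc_eq_face_sub (trunc_eq_sym T) _ => //; first exact: positive_sigma.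
by rewrite -(trunc_eq_low T).
Qed.

(** A minimal set is extended, one element at a time, as in the greedy
    algorithm; the faces determine the value at each new element. *)
Lemma face_eq_min_set nu nu' k : sg nu -> (k <= d)%N ->
    (forall j, (1 <= j <= k)%N -> face_of L e j nu = face_of L e j nu' /\
                                  ordJ L e j nu = ordJ L e j nu') ->
  exists2 B, min_set nu k B & forall b, b \in B ->
    pairing nu (toR (e b)) = pairing nu' (toR (e b)).
Proof.
move=> snu; elim: k => [|k IHk] kd F.
  have [B mB] := min_set_exists Le L_generates snu (leq0n d); exists B => // b.
  by have [/eqP] := mB; rewrite cards_eq0 => /eqP ->; rewrite inE.
have [|B [Bk iB BE] Bnu] := IHk (ltnW kd).
  by move=> j /andP[j1 jk]; apply: F; rewrite j1 ltnW.
have [B' [B'k iB' B'E]] := min_set_exists Le L_generates snu kd.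
have [|b bB' nb] := @gen_rank_exchange R d n e B B'.
  by rewrite (eqP iB) (eqP iB') Bk B'k.
have [ibB nbB] := indepU1 iB nb.
have cbB : #|b |: B| = k.+1 by rewrite cardsU1 nbB Bk.
have mbB : min_set nu k.+1 (b |: B).
  split=> //; apply/eqP; rewrite eq_le (ordJ_le_wt Le) // andbT wtU1 // BE -B'E.
  rewrite (wtD1 _ _ bB') lerD2l; apply: (ordJ_le_wt Le snu); rewrite ?indepD1 //.
  by move: B'k; rewrite (cardsD1 b) bB' => -[].
exists (b |: B) => // c /setU1P[->|]; last exact: Bnu.
have [|Fk Ok] := F k.+1; first by rewrite leqnn.
have := min_set_face mbB; rewrite Fk => -[_]; rewrite pairing_vertex -Ok.
have [_ _ <-] := mbB; rewrite !wtU1 // (_ : wt nu' B = wt nu B).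
  by move/addIr.
by apply: eq_bigr => i /Bnu.
Qed.

(** [nu] and [nu'] agree on a basis of the span of [low nu s]. *)
Lemma face_eq_trunc s nu nu' k : sg nu -> sg nu' ->
    k = gen_rank (low nu s) -> k = gen_rank (low nu' s) ->
    (forall j, (1 <= j <= k)%N -> face_of L e j nu = face_of L e j nu' /\
                                  ordJ L e j nu = ordJ L e j nu') ->
  trunc_eq s nu nu'.
Proof.
move=> snu snu' ks ks' F; have kd : (k <= d)%N by rewrite ks rank_leq_col.
suff half nu1 nu2 : sg nu1 -> k = gen_rank (low nu1 s) ->
    (forall j, (1 <= j <= k)%N -> face_of L e j nu1 = face_of L e j nu2 /\
                                  ordJ L e j nu1 = ordJ L e j nu2) ->
    forall i, i \in low nu1 s -> 
    pairing nu1 (toR (e i)) = pairing nu2 (toR (e i)).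
  move=> i /orP[il|il]; first by apply: half => //; rewrite inE.
  by apply/esym/half => //; [move=> j /F [-> ->]|rewrite inE].
move=> snu1 ks1 F1 i il; have [B mB Bnu] := face_eq_min_set snu1 kd F1.
have Bl : B \subset low nu1 s.
  by apply: (min_set_low Le snu1 mB); rewrite ks1.
have [Bk iB _] := mB.
have iBspan : (toR (e i) <= gen_span B)%MS.
  by apply: (gen_span_eq Bl) il; rewrite (eqP iB) Bk.
apply/eqP; rewrite -subr_eq0 -pairingBl; apply/eqP.
by apply: pairing_gen_span iBspan => b /Bnu; rewrite pairingBl => ->; rewrite subrr.
Qed.

(** The cone of the intersection of the fans whose relative interior contains
    [nu]. *)
Definition fan_cone k nu : set 'rV[R]_d :=
  [set nu' | sg nu' /\ forall i, (1 <= i <= k)%N ->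
               face_of L e i nu `<=` face_of L e i nu'].

Lemma sub_faceP i nu nu' :
  (forall w, face_of L e i nu w -> pairing nu' w = ordJ L e i nu') <->
  face_of L e i nu `<=` face_of L e i nu'.
Proof.
split=> F w wF; last by have [] := F w wF.
by split; [exact: wF.1|exact: F].
Qed.

Lemma meet_fan_cone k nu : sg nu -> (0 < k)%N -> meet_fan L e k (fan_cone k nu).
Proof.
move=> snu k0; exists (fun i => [set nu' | sg nu' /\
    forall w, face_of L e i nu w -> pairing nu' w = ordJ L e i nu']).
split=> [i ik|]; first by exists nu.
apply/seteqP; split=> [nu' [snu' F] i ik|nu' F].
  by split=> //; apply/sub_faceP/F.
split=> [|i ik]; first by have [] := F 1%N; rewrite /= ?k0.
by apply/sub_faceP; have [] := F i ik.
Qed.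

(** Moving slightly from a relative interior point away from any point of the
    cone stays in the cone; linear forms that vanish at an interior point of a
    segment and have a sign at its ends vanish along it. *)
Lemma relint_meet_fan k tau nu : (0 < k <= d)%N -> meet_fan L e k tau ->
  relint tau nu -> sg nu /\ tau = fan_cone k nu.
Proof.
move=> /andP[k0 kd] [T [Tfan tauE]] rnu.
have tau_sigma nu' : tau nu' -> sg nu'.
  rewrite tauE => /(_ 1%N); have [|nu1 _ ->] := Tfan 1%N; first by rewrite k0.
  by case=> //=; rewrite k0.
have snu : sg nu by apply: tau_sigma; exact: rnu.1.
split=> //; apply/seteqP; split=> nu' nu'P.
  have snu' := tau_sigma _ nu'P; split=> // i ik w wF.
  have [t t0 tau2] := relint_extend rnu nu'P.
  set nu2 := nu + t *: (nu - nu') in tau2; have snu2 := tau_sigma _ tau2.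
  have [nu1 snu1 TiE] := Tfan i ik.
  have id : (i <= d)%N by case/andP: ik => _ /leq_trans; apply.
  have [B /min_set_face B1] := min_set_exists Le L_generates snu1 id.
  have eqB x : tau x -> pairing x (vertex B) = ordJ L e i x.
    by rewrite tauE => /(_ i ik); rewrite TiE => -[_]; apply.
  split; first exact: wF.1; apply/eqP; rewrite eq_le (ordJ_le Le snu' wF.1) andbT.
  have := ordJ_le Le snu2 wF.1; rewrite -(eqB _ tau2) /nu2 !pairingDl !pairingZl.
  rewrite !pairingBl (eqB _ rnu.1) (eqB _ nu'P) wF.2 lerD2l ler_pM2l //.
  by rewrite lerD2l lerN2.
rewrite tauE => i ik; have [nu1 snu1 TiE] := Tfan i ik; rewrite TiE.
split; first exact: nu'P.1; apply/sub_faceP => w w1; apply: (nu'P.2 i ik).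
have := rnu.1; rewrite tauE => /(_ i ik); rewrite TiE => -[_ /sub_faceP]; exact.
Qed.

(** Near [nu], the vertices of larger weight remain so, while the affine hull of
    the cone forces the minimal vertices to keep equal weights. *)
Lemma relint_fan_cone k nu : (k <= d)%N -> positive nu -> relint (fan_cone k nu) nu.
Proof.
move=> kd nup; have snu := positive_sigma nup; split; first by split=> // i _ w.
have near1 : \forall y \near nu, forall i, 0 < pairing y (toR (e i)).
  apply: (@filter_forall _ _ (fun i y => 0 < pairing y (toR (e i))) (nbhs nu)).
  by move=> i; apply: near_pairing_gt.
have near2 : \forall y \near nu, forall BB : {set 'I_n} * {set 'I_n},
    wt nu BB.1 < wt nu BB.2 -> 0 < pairing y (vertex BB.2 - vertex BB.1).
  apply: (@filter_forall _ _ (fun BB y => wt nu BB.1 < wt nu BB.2 ->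
    0 < pairing y (vertex BB.2 - vertex BB.1)) (nbhs nu)) => BB.
  have [lt|] := boolP (wt nu BB.1 < wt nu BB.2); last by move=> _; apply: nearW.
  have : 0 < pairing nu (vertex BB.2 - vertex BB.1).
    by rewrite pairingBr !pairing_vertex subr_gt0.
  by move=> /near_pairing_gt pos; apply: filterS pos.
apply: filterS (filterI near1 near2) => y [y1 y2] hy.
have sy : sg y by apply/(sigmaP Le) => i; apply: ltW.
split=> // i ik.
have id : (i <= d)%N by case/andP: ik => _ /leq_trans; apply.
have [B0 mB0] := min_set_exists Le L_generates snu id.
have ylin w : face_of L e i nu w -> pairing y w = pairing y (vertex B0).
  (* an affine subspace that contains the cone *)
  move=> wF; pose Q := [set z | pairing z w = pairing z (vertex B0)].
  apply: (hy Q); split=> [t a b /= aE bE|z [sz zF]].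
    by rewrite /Q /= !pairingDl !pairingZl aE bE.
  by rewrite /Q /= (zF i ik w wF).2 (zF i ik _ (min_set_face mB0)).2.
have yE : ordJ L e i y = pairing y (vertex B0).
  apply/eqP; rewrite eq_le (ordJ_le Le sy (min_set_face mB0).1) /=.
  have [B1 [B1i iB1 <-]] := min_set_exists Le L_generates sy id.
  have [B0i iB0 B0E] := mB0; rewrite -[wt y B1]pairing_vertex.
  have /predU1P[B1E|] :
      (ordJ L e i nu == wt nu B1) || (ordJ L e i nu < wt nu B1).
    by rewrite -le_eqVlt (ordJ_le_wt Le).
    by rewrite ylin //; apply: min_set_face.
  by rewrite -B0E => /(y2 (B0, B1)) /=; rewrite pairingBr subr_gt0 => /ltW.
by move=> w wF; split; [exact: wF.1|rewrite ylin // yE].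
Qed.

Lemma nonzero_face theta : is_face theta sg -> theta <> [set 0] ->
  exists nu, [/\ theta nu, sg nu & nu != 0].
Proof.
move=> [w _ thE] th0; apply: contrapT => nex; apply: th0; apply/seteqP; split.
  move=> nu th_nu; apply/eqP/negPn/negP => nu0; apply: nex; exists nu; split=> //.
  by move: th_nu; rewrite thE => -[].
move=> _ ->; rewrite thE; split; last by rewrite pairing0l.
by apply/(sigmaP Le) => i; rewrite pairing0l.
Qed.

Lemma positive_face_sub nu k : positive nu -> face_of L e k nu `<=` K.
Proof.
move=> nup x [+ _]; apply: newton_ind => [t y z /andP[t0 t1] Ky Kz|B w _ _ Kw].
  by apply: sigma_dualD; apply: sigma_dualZ; rewrite // subr_ge0.
apply: sigma_dualD => //; rewrite /vertex real_of_lattice_sum.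
by apply: sigma_dual_sum => i _; apply: sigma_dual_gen.
Qed.

(** With [k] the rank of the generators of value at most [s], a minimal vertex
    is the sum of a basis of their span, so a linear form of [sigma] vanishes
    somewhere on the face exactly when it kills all these generators. *)
Lemma face_not_interior s nu k : positive nu -> k = gen_rank (low nu s) ->
  ~ (face_of L e k nu `<=` interior K) <->
  exists theta, [/\ is_face theta sg, theta <> [set 0] &
                    forall i, i \in low nu s -> perp theta (e i)].
Proof.
move=> nup ks; have snu := positive_sigma nup.
have kd : (k <= d)%N by rewrite ks rank_leq_col.
split=> [nF|[theta [th_face th0 th_low]] F]; last first.
  have [nu0 [th_nu0 snu0 nu0_neq0]] := nonzero_face th_face th0.
  have [B mB] := min_set_exists Le L_generates snu kd.
  have := interior_pairing_gt0 (F _ (min_set_face mB)) snu0 nu0_neq0.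
  rewrite pairing_vertex /wt big1 ?ltxx // => i iB; apply: th_low => //.
  have kl : (k <= gen_rank (low nu s))%N by rewrite ks.
  by have /fintype.subsetP := min_set_low Le snu mB kl; apply.
have [w [wF nw]] : exists w, face_of L e k nu w /\ ~ interior K w.
  apply: contrapT => nex; apply: nF => w wF; apply: contrapT => nw.
  by apply: nex; exists w.
have Kw := positive_face_sub nup wF.
have [nu0 [snu0 nu0_neq0 nu0w]] := sigma_dual_support Le Kw nw.
exists [set nu' | sg nu' /\ pairing nu' w = 0]; split.
- by exists w => // nu' snu'; rewrite pairingC; apply: snu'.
- move=> th0; have : [set nu' | sg nu' /\ pairing nu' w = 0] nu0 by [].
  by rewrite th0 => /= nu00; rewrite nu00 eqxx in nu0_neq0.
move=> i il nu' [snu' nu'w]; apply/eqP/negPn/negP => nu'i.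
suff : face_of L e k nu `<=` [set x | 0 < pairing nu' x].
  by move=> /(_ _ wF) /=; rewrite nu'w ltxx.
apply: face_ind => //; first exact: open_halfspace_segment_closed.
move=> B mB /=; have [Bk iB _] := mB.
have Bl : B \subset low nu s.
  by apply: (min_set_low Le snu mB); rewrite ks.
rewrite lt_neqAle eq_sym; apply/andP; split; last first.
  rewrite pairing_vertex; apply: sumr_ge0 => b _.
  by move/(sigmaP Le): snu'.
apply: contra nu'i => /eqP /(vertex_kill snu') B0; apply/eqP.
apply: (pairing_gen_span B0); apply: (gen_span_eq Bl _ il).
by rewrite (eqP iB) Bk.
Qed.

End Faces.

(** * Extension of homomorphisms to divisible groups *)

Section DivisibleExtension.
Variable V : zmodType.
Hypothesis V_divisible : forall (x : V) k, (0 < k)%N -> exists y, y *+ k = x.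

Definition intmx_act p q (A : 'M[int]_(p, q)) (x : 'I_q -> V) : 'I_p -> V :=
  fun i => \sum_j x j *~ A i j.

Lemma intmx_actM p q r (A : 'M_(p, q)) (B : 'M_(q, r)) x i :
  intmx_act (A *m B) x i = intmx_act A (intmx_act B x) i.
Proof.
rewrite /intmx_act; under [RHS]eq_bigr do rewrite mulrz_suml.
rewrite exchange_big; apply: eq_bigr => k _.
rewrite mxE (big_morph _ (mulrzDr (x k)) (mulr0z (x k))).
by apply: eq_bigr => j _; rewrite -mulrzA mulrC.
Qed.

Lemma intmx_act1 p x i : intmx_act (1%:M : 'M_p) x i = x i.
Proof.
rewrite /intmx_act (bigD1 i) //= mxE eqxx mulr1z big1 ?addr0 // => j ji.
by rewrite mxE eq_sym (negbTE ji) mulr0z.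
Qed.

Lemma eq_intmx_act p q (A : 'M_(p, q)) x y i :
  x =1 y -> intmx_act A x i = intmx_act A y i.
Proof. by move=> xy; apply: eq_bigr => j _; rewrite xy. Qed.

Lemma divisible_int (x : V) (k : int) : k != 0 -> exists y, y *~ k = x.
Proof.
case: k => k k0; first by have [|y <-] := V_divisible x (_ : 0 < k)%N;
  [rewrite lt0n|exists y].
have [y yx] := V_divisible (- x) (ltn0Sn k); exists y.
by rewrite NegzE mulrNz -pmulrn yx opprK.
Qed.

(** The Smith normal form makes the system diagonal: a nonzero diagonal entry is
    inverted by divisibility, and a zero row is a relation that the right-hand
    side satisfies. *)
Lemma divisible_solve n d (E : 'M[int]_(n, d)) (c : 'I_n -> V) :
    (forall a : 'rV_n, a *m E = 0 -> \sum_i c i *~ a 0 i = 0) ->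
  exists chi, forall i, c i = intmx_act E chi i.
Proof.
move=> cE; have [A uA [B uB [s _ ED]]] := int_Smith_normal_form E.
set D := (\matrix_(i, j) _) in ED.
pose c' := intmx_act (invmx A) c.
have c'0 i : row i D = 0 -> c' i = 0.
  move=> Di; have := cE (row i (invmx A)); rewrite ED -!mulmxA -row_mul mulKmx //.
  rewrite row_mul Di mul0mx => /(_ erefl) <-.
  by apply: eq_bigr => j _; rewrite mxE.
have [y yD] : exists y, forall i, c' i = intmx_act D y i.
  have /choice [y yP] : forall j : 'I_d, exists y,
      forall i : 'I_n, i = j :> nat -> s`_j != 0 -> y *~ s`_j = c' i.
    move=> j; have [jn|nj] := ltnP j n; last first.
      by exists 0 => i ij; have := ltn_ord i; rewrite ij ltnNge nj.
    have [sj|sj] := eqVneq s`_j 0; first by exists 0.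
    have [y ys] := divisible_int (c' (Ordinal jn)) sj; exists y => i ij _.
    by rewrite ys; congr c'; apply: val_inj.
  exists y => i; have [id|di] := ltnP i d; last first.
    have Di0 j : D i j = 0.
      rewrite mxE; case: eqP => // ij; have := ltn_ord j.
      by rewrite -ij ltnNge di.
    rewrite c'0; last by apply/rowP => j; rewrite mxE Di0 mxE.
    by rewrite /intmx_act big1 // => j _; rewrite Di0 mulr0z.
  have Dij j : D i j = if j == Ordinal id then s`_i else 0.
    by rewrite mxE -val_eqE /= eq_sym; case: eqP.
  rewrite /intmx_act (bigD1 (Ordinal id)) //= Dij eqxx big1 ?addr0; last first.
    by move=> j ji; rewrite Dij (negbTE ji) mulr0z.
  have [si|si] := eqVneq s`_i 0; last by rewrite (yP (Ordinal id) i).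
  rewrite si mulr0z c'0 //; apply/rowP => j; rewrite mxE Dij si mxE.
  by case: ifP.
exists (intmx_act (invmx B) y) => i.
rewrite ED intmx_actM -intmx_actM -mulmxA intmx_actM.
transitivity (intmx_act A c' i); first by rewrite -intmx_actM mulmxV // intmx_act1.
apply: eq_intmx_act => j; rewrite yD intmx_actM; apply: eq_intmx_act => k.
by rewrite -intmx_actM mulmxV // intmx_act1.
Qed.

Variables (d n : nat) (e : 'I_n -> 'rV[int]_d).

Definition char_of (chi : 'I_d -> V) (u : 'rV[int]_d) : V :=
  \sum_b chi b *~ u 0 b.

Lemma char_of_weight chi (m : multinom n) :
  \sum_i char_of chi (e i) *+ m i = char_of chi (weight e m).
Proof.
rewrite /char_of /weight; under eq_bigr do rewrite -sumrMnl.
rewrite exchange_big; apply: eq_bigr => b _.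
rewrite summxE (big_morph _ (mulrzDr (chi b)) (mulr0z (chi b))).
apply: eq_bigr => i _.
by rewrite mulmxnE [LHS]pmulrn -mulrzA [in RHS]pmulrn mulrzz.
Qed.

Definition supported (I : pred 'I_n) (m : multinom n) := forall i, m i != 0%N -> I i.

(** The system [divisible_solve] for the prescribed values, completed by zero
    rows; an integer relation is the difference of its positive and negative
    parts, which are exponents of equal weight. *)
Lemma divisible_extension (I : pred 'I_n) (c : 'I_n -> V) :
    (forall m m', supported I m -> supported I m' -> weight e m = weight e m' ->
       \sum_i c i *+ m i = \sum_i c i *+ m' i) ->
  exists chi, forall i, I i -> c i = char_of chi (e i).
Proof.
move=> cI; pose E : 'M[int]_(n, d) := \matrix_i (if I i then e i else 0).
pose c1 i := if I i then c i else 0.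
have [chi chiP] : exists chi, forall i, c1 i = intmx_act E chi i.
  apply: divisible_solve => a aE.
  pose pos : multinom n :=
    Multinom [tuple if I i && (0 <= a 0 i) then absz (a 0 i) else 0%N | i < n].
  pose neg : multinom n :=
    Multinom [tuple if I i && (a 0 i < 0) then absz (a 0 i) else 0%N | i < n].
  have posE i : pos i = if I i && (0 <= a 0 i) then absz (a 0 i) else 0%N.
    exact: mnmE.
  have negE i : neg i = if I i && (a 0 i < 0) then absz (a 0 i) else 0%N.
    exact: mnmE.
  have split_a (W : zmodType) (x : W) i :
      (if I i then x else 0) *~ a 0 i = x *+ pos i - x *+ neg i.
    rewrite posE negE; case: (I i); last by rewrite mul0rz subrr.
    case: (a 0 i) => k; first by rewrite lez_nat /= subr0.
    by rewrite NegzE /= sub0r mulrNz.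
  have /cI : supported I pos by move=> i; rewrite posE; case: (I i).
  move=> /(_ neg) cpn; transitivity (\sum_i (c i *+ pos i - c i *+ neg i)).
    by apply: eq_bigr => i _; apply: split_a.
  rewrite sumrB cpn ?subrr //; first by move=> i; rewrite negE; case: (I i).
  apply/eqP; rewrite -subr_eq0 /weight -sumrB -[X in _ == X]aE mulmx_sum_row.
  by apply/eqP/eq_bigr => i _; rewrite rowK -split_a -scaler_int intz.
exists chi => i Ii; have := chiP i; rewrite /c1 Ii => ->.
by apply: eq_bigr => b _; rewrite mxE Ii.
Qed.

End DivisibleExtension.

(** * Lifting truncated units *)

(** Additive notation makes [divisible_extension] apply to the multiplicative
    group of a field. *)
Record cstar (K : fieldType) := CStar { cval : K; cval_neq0 : cval != 0 }.

Section MultiplicativeGroup.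
Variable K : fieldType.
HB.instance Definition _ := [isSub for @cval K].
HB.instance Definition _ := [Choice of cstar K by <:].

Implicit Types x y z : cstar K.

Definition cstar1 : cstar K := CStar (oner_neq0 K).
Definition cstar_inv x : cstar K := CStar (invr_neq0 (cval_neq0 x)).
Definition cstar_mul x y : cstar K := CStar (mulf_neq0 (cval_neq0 x) (cval_neq0 y)).

Fact cstar_mulA : associative cstar_mul.
Proof. by move=> x y z; apply: val_inj; rewrite /= mulrA. Qed.
Fact cstar_mulC : commutative cstar_mul.
Proof. by move=> x y; apply: val_inj; rewrite /= mulrC. Qed.
Fact cstar_mul1 : left_id cstar1 cstar_mul.
Proof. by move=> x; apply: val_inj; rewrite /= mul1r. Qed.
Fact cstar_mulV : left_inverse cstar1 cstar_inv cstar_mul.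
Proof. by move=> x; apply: val_inj; rewrite /= mulVf // cval_neq0. Qed.

HB.instance Definition _ := GRing.isZmodule.Build (cstar K)
  cstar_mulA cstar_mulC cstar_mul1 cstar_mulV.

Lemma cvalMn x k : cval (x *+ k) = cval x ^+ k.
Proof. by elim: k => // k IHk; rewrite mulrS exprS -IHk. Qed.

Lemma cval_sum (I : Type) (r : seq I) (P : pred I) (F : I -> cstar K) :
  cval (\sum_(i <- r | P i) F i) = \prod_(i <- r | P i) cval (F i).
Proof. exact: (big_morph (@cval K)). Qed.

Lemma cval_inj : injective (@cval K). Proof. exact: val_inj. Qed.

End MultiplicativeGroup.

Section UnitLift.
Variables (R : realType) (d n : nat) (e : 'I_n -> 'rV[int]_d).
Local Notation C := (R[i]).

Lemma complex_divisible (x : C) k : (0 < k)%N -> exists y, y *+ k = x.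
Proof.
move=> k0; exists (x / k%:R).
by rewrite -[_ *+ k]mulr_natr mulfVK // pnatr_eq0 -lt0n.
Qed.

Lemma cstar_divisible (x : cstar C) k : (0 < k)%N -> exists y, y *+ k = x.
Proof.
move=> k0; have r0 : k.-root (cval x) != 0.
  apply: contraNneq (cval_neq0 x) => r0.
  by rewrite -(rootCK k0 (cval x)) r0 expr0n gtn_eqF.
exists (CStar r0); apply: cval_inj; rewrite cvalMn /=.
exact: rootCK.
Qed.

Lemma mmap1_supported (S : comNzRingType) (P : pred 'I_n) (h h' : 'I_n -> S) m :
  supported P m -> (forall i, P i -> h i = h' i) -> mmap1 h m = mmap1 h' m.
Proof.
move=> Pm hh; apply: eq_bigr => i _; have [-> //|mi] := eqVneq (m i) 0%N.
by rewrite hh // Pm.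
Qed.

(** A unit is given by its constant term, in a divisible group, and by the
    coefficients of its logarithmic derivative, on which the relations become
    linear. The coordinate of degree [j] is prescribed for the indices [i] with
    [o i + j <= s] only, and each of these coordinates is extended separately
    by [divisible_extension]. *)
Lemma lift_units (o : 'I_n -> nat) s (u : 'I_n -> fps C) :
    (forall i, (o i <= s)%N -> fps_coef (u i) 0 != 0) ->
    (forall j m m', (j <= s)%N ->
       supported (fun i => o i + j <= s)%N m ->
       supported (fun i => o i + j <= s)%N m' -> weight e m = weight e m' ->
       fps_eqmod j.+1 (mmap1 u m) (mmap1 u m')) ->
  exists v : 'I_n -> fps C, [/\ forall i, fps_coef (v i) 0 != 0, binomial_rel e v &
    forall i, (o i <= s)%N -> fps_eqmod (s - o i).+1 (v i) (u i)].
Proof.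
move=> u0 ubin; (* coordinates of order larger than [s] are not constrained *)
pose u1 i := if (o i <= s)%N then u i else 1.
have u1_neq0 i : fps_coef (u1 i) 0 != 0.
  by rewrite /u1; case: ifP => [/u0 //|_]; rewrite oner_eq0.
have u1bin j m m' : (j <= s)%N -> supported (fun i => o i + j <= s)%N m ->
    supported (fun i => o i + j <= s)%N m' -> weight e m = weight e m' ->
    fps_eqmod j.+1 (mmap1 u1 m) (mmap1 u1 m').
  move=> js mj mj' mm'; have uu1 i : (o i + j <= s)%N -> u1 i = u i.
    by rewrite /u1 => /(leq_trans (leq_addr _ _)) ->.
  by rewrite (mmap1_supported mj uu1) (mmap1_supported mj' uu1); apply: ubin.
pose c i : cstar C := CStar (u1_neq0 i).
have [chi0 chi0P] : exists chi0, forall i, (o i + 0 <= s)%N ->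
    c i = char_of chi0 (e i).
  apply: (divisible_extension cstar_divisible) => m m' ms ms' mm'.
  apply: cval_inj; rewrite !cval_sum; have := u1bin 0%N m m' isT ms ms' mm' 0%N isT.
  rewrite !fps_coef_prod0.
  under eq_bigr do rewrite fps_coefX0; under [in RHS]eq_bigr do rewrite fps_coefX0.
  by under [in X in _ -> X]eq_bigr do rewrite cvalMn;
     under [in X in _ -> _ = X]eq_bigr do rewrite cvalMn.
have /choice [gl glP] : forall i, exists g, dlog (u1 i) g.
  by move=> i; apply: dlog_exists.
have dlog_mmap1 (w : 'I_n -> fps C) (G : 'I_n -> fps C) m :
    (forall i, dlog (w i) (G i)) -> dlog (mmap1 w m) (\sum_i G i *+ m i).
  by move=> wG; apply: dlog_prod => i _; apply: dlogX.
have /choice [x xP] : forall j, exists chi : 'I_d -> C, (j < s)%N ->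
    forall i, (o i + j.+1 <= s)%N -> fps_coef (gl i) j = char_of chi (e i).
  move=> j; have [js|] := ltnP j s; last by exists (fun=> 0).
  have [|chi chiP] := @divisible_extension _ complex_divisible d n e
      (fun i => o i + j.+1 <= s)%N (fun i => fps_coef (gl i) j); last by exists chi.
  move=> m m' ms ms' mm'; have := u1bin j.+1 m m' js ms ms' mm'.
  move/(eqmod_dlog (dlog_mmap1 _ _ m glP) (dlog_mmap1 _ _ m' glP)).
  move=> /(_ (mmap1_coef0 m u1_neq0)) /(_ j (ltnSn j)).
  rewrite !fps_coef_sum; under eq_bigr do rewrite fps_coefMn.
  by under [in RHS]eq_bigr do rewrite fps_coefMn.
pose G i : fps C := Fps (fun j => char_of (x j) (e i)).
have /choice [v vP] : forall i, exists v,
    fps_coef v 0 = cval (char_of chi0 (e i)) /\ dlog v (G i).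
  by move=> i; have [v v0 vG] := dlog_surj (cval (char_of chi0 (e i))) (G i); exists v.
have v0 i := (vP i).1; have vG i := (vP i).2.
exists v; split=> [i|m m' mm'|i ois].
- by rewrite v0 cval_neq0.
- have GE (p : multinom n) :
      \sum_i G i *+ p i = Fps (fun j => char_of (x j) (weight e p)).
    apply: fpsP => j; rewrite fps_coef_sum /= -char_of_weight.
    by apply: eq_bigr => i _; rewrite fps_coefMn.
  have cE (p : multinom n) : fps_coef (mmap1 v p) 0 = cval (char_of chi0 (weight e p)).
    rewrite fps_coef_prod0 -char_of_weight cval_sum.
    by apply: eq_bigr => i _; rewrite fps_coefX0 v0 cvalMn.
  apply: (@dlog_inj _ _ _ (\sum_i G i *+ m i)); [exact: dlog_mmap1| |].
    by rewrite GE mm' -GE; apply: dlog_mmap1.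
  by rewrite !cE mm'.
- have -> : u i = u1 i by rewrite /u1 ois.
  apply: (dlog_eqmod (vG i) (glP i)).
    by rewrite v0 -chi0P // addn0.
  move=> j js; have oj : (o i + j.+1 <= s)%N.
    by rewrite addnS -ltn_subRL.
  by rewrite (xP j) // (leq_trans _ oj) // leq_addl.
Qed.

End UnitLift.

(** * Jets of arcs of given order *)

Section PolynomialFunctions.
Variables (K : fieldType) (a b : nat).
Implicit Types (f g : 'M[K]_(a, b) -> K) (F G : 'M[K]_(a, b) -> fps K).

Definition polyfun f := exists p : mpoly (a * b) K,
  forall x, f x = meval (fun i => mxvec x 0 i) p.

Lemma polyfun_const c : polyfun (fun=> c).
Proof. by exists (mpolyC _ c) => x; rewrite mevalC. Qed.

Lemma polyfun_coord i j : polyfun (fun x => x i j).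
Proof.
exists (mpolyX K (mnm1 (mxvec_index i j))) => x.
by rewrite mevalXU mxvecE.
Qed.

Lemma polyfunD f g : polyfun f -> polyfun g -> polyfun (fun x => f x + g x).
Proof. by move=> [p pf] [q qg]; exists (p + q) => x; rewrite mevalD pf qg. Qed.

Lemma polyfunM f g : polyfun f -> polyfun g -> polyfun (fun x => f x * g x).
Proof. by move=> [p pf] [q qg]; exists (p * q) => x; rewrite mevalM pf qg. Qed.

Lemma polyfunB f g : polyfun f -> polyfun g -> polyfun (fun x => f x - g x).
Proof. by move=> [p pf] [q qg]; exists (p - q) => x; rewrite mevalB pf qg. Qed.

Lemma polyfun_sum (I : Type) (r : seq I) (P : pred I)
    (f : I -> 'M[K]_(a, b) -> K) : (forall i, P i -> polyfun (f i)) ->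
  polyfun (fun x => \sum_(i <- r | P i) f i x).
Proof.
move=> Pf; elim: r => [|i r IHr].
  by have [p pE] := polyfun_const 0; exists p => x; rewrite big_nil -pE.
have [Pi|nPi] := boolP (P i); last first.
  by have [p pE] := IHr; exists p => x; rewrite big_cons (negbTE nPi) pE.
have [p pE] := polyfunD (Pf i Pi) IHr.
by exists p => x; rewrite big_cons Pi pE.
Qed.

Lemma polyfun_prod (I : Type) (r : seq I) (P : pred I)
    (f : I -> 'M[K]_(a, b) -> K) : (forall i, P i -> polyfun (f i)) ->
  polyfun (fun x => \prod_(i <- r | P i) f i x).
Proof.
move=> Pf; elim: r => [|i r IHr].
  by have [p pE] := polyfun_const 1; exists p => x; rewrite big_nil -pE.
have [Pi|nPi] := boolP (P i); last first.
  by have [p pE] := IHr; exists p => x; rewrite big_cons (negbTE nPi) pE.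
have [p pE] := polyfunM (Pf i Pi) IHr.
by exists p => x; rewrite big_cons Pi pE.
Qed.

Definition polyfps F := forall k, polyfun (fun x => fps_coef (F x) k).

Lemma polyfpsM F G : polyfps F -> polyfps G -> polyfps (fun x => F x * G x).
Proof.
move=> pF pG k.
apply: (@polyfun_sum _ (index_enum 'I_k.+1) xpredT (fun i x =>
  fps_coef (F x) i * fps_coef (G x) (k - i))) => i _.
exact: polyfunM.
Qed.

Lemma polyfpsX F m : polyfps F -> polyfps (fun x => F x ^+ m).
Proof.
move=> pF; elim: m => [|m IHm] k; first exact: polyfun_const.
have [p pE] := polyfpsM pF IHm k.
by exists p => x; rewrite exprS pE.
Qed.

Lemma polyfps_mmap1 n (h : 'I_n -> 'M[K]_(a, b) -> fps K) m :
  (forall i, polyfps (h i)) -> polyfps (fun x => mmap1 (fun i => h i x) m).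
Proof.
move=> ph; rewrite /mmap1; elim: (index_enum _) => [|i r IHr] k.
  have [p pE] := polyfun_const (fps_coef (1 : fps K) k).
  by exists p => x; rewrite big_nil -pE.
have [p pE] := polyfpsM (polyfpsX (m i) (ph i)) IHr k.
by exists p => x; rewrite big_cons pE.
Qed.

Lemma zariski_closed_zeros (S : set ('M[K]_(a, b) -> K)) : S `<=` polyfun ->
  zariski_closed [set x | forall f, S f -> f x = 0].
Proof.
move=> Sp; exists [set p | exists2 f, S f &
  forall x, f x = meval (fun i => mxvec x 0 i) p].
apply/seteqP; split=> x /= xS => [p [f Sf <-]|f Sf]; first exact: xS.
by have [p pE] := Sp f Sf; rewrite pE; apply: xS; exists f.
Qed.

End PolynomialFunctions.

Section Jets.
Variables (R : realType) (d n : nat) (L : set 'rV[int]_d) (e : 'I_n -> 'rV[int]_d).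
Hypothesis Le : smallest (@submonoid 'rV[int]_d) (range e) = L.
Local Notation C := (R[i]).
Local Notation toR := (@real_of_lattice R d).
Implicit Types (h : 'I_n -> fps C) (o : 'I_n -> nat) (nu : 'rV[int]_d).

Lemma jet_eqP s h h' :
  jet R s h = jet R s h' <-> forall i, fps_eqmod s.+1 (h i) (h' i).
Proof.
split=> [hh i k ks|hh].
  by have := congr1 (fun J : 'M_(_, _) => J i (Ordinal ks)) hh; rewrite !mxE.
by apply/matrixP => i j; rewrite !mxE hh.
Qed.

Definition orders nu o := forall i, pairing nu (e i) = (o i)%:Z /\ (0 < o i)%N.

Lemma arcs_ord_units nu o h : orders nu o -> arcs_ord R L e nu h <->
  exists v, [/\ forall i, h i = fps_mon (o i) * v i,
                forall i, fps_coef (v i) 0 != 0 & binomial_rel e v].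
Proof.
move=> nuo; apply: (arcs_ordP Le) => i; first exact: (nuo i).1.
exact: (nuo i).2.
Qed.

Lemma arcs_ord_fps_order nu o h i : orders nu o -> arcs_ord R L e nu h ->
  fps_order (o i) (h i).
Proof.
move=> nuo /(arcs_ord_units _ nuo) [v [hv v0 _]].
by apply/fps_orderP; exists (v i).
Qed.

(** Multiplying the unit parts by other powers of [t], of exponents larger than
    [s], does not change the jet. *)
Lemma jets_trunc s nu nu' o o' : orders nu o -> orders nu' o' ->
    (forall i, (o i <= s)%N || (o' i <= s)%N -> o i = o' i) ->
  jet R s @` arcs_ord R L e nu `<=` jet R s @` arcs_ord R L e nu'.
Proof.
move=> nuo nuo' oo' _ [h /(arcs_ord_units _ nuo) [v [hv v0 vb]] <-].
exists (fun i => fps_mon (o' i) * v i).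
  by apply/(arcs_ord_units _ nuo'); exists v.
apply/jet_eqP => i k ks; rewrite hv !fps_coef_monM.
have [ois|sois] := boolP ((o i <= s)%N || (o' i <= s)%N); first by rewrite oo'.
move: sois; rewrite negb_or -!ltnNge => /andP[so so'].
by rewrite !(leq_trans ks).
Qed.

Lemma common_jet_trunc s nu nu' o o' h h' : orders nu o -> orders nu' o' ->
    arcs_ord R L e nu h -> arcs_ord R L e nu' h' -> jet R s h = jet R s h' ->
  forall i, (o i <= s)%N || (o' i <= s)%N -> o i = o' i.
Proof.
move=> nuo nuo' hnu hnu' /jet_eqP hh' i.
have [ho h0] := arcs_ord_fps_order i nuo hnu.
have [ho' h0'] := arcs_ord_fps_order i nuo' hnu'.
move=> ois; apply/eqP; rewrite eqn_leq.
have lt_neq a b (f f' : fps C) : fps_eqmod s.+1 f f' -> fps_coef f a != 0 ->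
    (forall j, (j < b)%N -> fps_coef f' j = 0) -> (a <= s)%N -> (b <= a)%N.
  by move=> ff fa fb als; rewrite leqNgt; apply: contra fa => /fb <-; rewrite ff.
have hh := hh' i; have hhs := fps_eqmod_sym hh.
case/orP: ois => ois.
  have o'o := lt_neq _ _ _ _ hh ho h0' ois; rewrite o'o andbT.
  exact: (lt_neq _ _ _ _ hhs ho' h0 (leq_trans o'o ois)).
have oo' := lt_neq _ _ _ _ hhs ho' h0 ois; rewrite oo' /=.
exact: (lt_neq _ _ _ _ hh ho h0' (leq_trans oo' ois)).
Qed.

Lemma pairing_toR_weight (nu : 'rV[R]_d) (m : multinom n) :
  pairing nu (toR (weight e m)) = \sum_i pairing nu (toR (e i)) *+ m i.
Proof.
rewrite /weight real_of_lattice_sum pairing_sumr; apply: eq_bigr => i _.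
elim: (m i) => [|k IHk]; first by rewrite /real_of_lattice map_mx0 pairing0r.
by rewrite !mulrS real_of_latticeD pairingDr IHk.
Qed.

Lemma perp_weight (theta : set 'rV[R]_d) (m : multinom n) : theta `<=` sigma R L ->
  perp theta (weight e m) <-> forall i, m i != 0%N -> perp theta (e i).
Proof.
move=> th_sigma; split=> [pm i mi nu nu_th|pm nu nu_th]; last first.
  rewrite pairing_toR_weight big1 // => i _.
  by have [->|/pm ->] := eqVneq (m i) 0%N; rewrite ?mulr0n ?mul0rn.
have /sigmaP snu := th_sigma _ nu_th; have := pm nu nu_th.
rewrite pairing_toR_weight => /eqP; rewrite psumr_eq0 => [/allP /(_ i)|j _].
  by rewrite mem_index_enum mulrn_eq0 (negbTE mi) => /(_ isT) /eqP.
by rewrite mulrn_wge0 //; apply: snu.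
Qed.

(** Dropping the coordinates that do not lie in the orthogonal of [theta] sends
    an arc of the torus to an arc of the orbit closure; it does not change the
    jet when these coordinates vanish to an order larger than [s]. *)
Lemma jet_orbit_closure s nu o theta h : orders nu o -> theta `<=` sigma R L ->
    arcs_ord R L e nu h ->
  (jet R s @` arcs R e (L `&` perp theta)) (jet R s h) <->
  forall i, (o i <= s)%N -> perp theta (e i).
Proof.
move=> nuo th_sigma hnu; split=> [[h' /arcsP [_ hP _] /jet_eqP hh'] i ois|pe].
  apply: contrapT => npe; have [ho _] := arcs_ord_fps_order i nuo hnu.
  have := hP (mnm1 i); rewrite weightU mmap1U => h'i.
  by move: ho; rewrite -hh' // h'i ?fps_coef0 ?eqxx // => -[].
have [[/arcs_LP - /(_ Le) [h0 hb] _] _] := hnu.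
exists (fun i => if `[< perp theta (e i) >] then h i else 0); last first.
  apply/jet_eqP => i k ks; case: asboolP => // npe.
  have [_ ->] := arcs_ord_fps_order i nuo hnu; rewrite ?fps_coef0 //.
  by apply: leq_trans ks _; rewrite ltnNge; apply/negP => /pe.
have drop0 m : ~ perp theta (weight e m) ->
    mmap1 (fun i => if `[< perp theta (e i) >] then h i else 0) m = 0.
  move=> npm; have /existsNP [i /not_implyP [mi npi]] :
      ~ forall i, m i != 0%N -> perp theta (e i).
    by move=> pm; apply: npm; apply/perp_weight.
  rewrite /mmap1 (bigD1 i) //= asboolF // expr0n (negbTE mi) mul0r //.
have dropE m : perp theta (weight e m) ->
    mmap1 (fun i => if `[< perp theta (e i) >] then h i else 0) m = mmap1 h m.
  move=> /perp_weight - /(_ th_sigma) pm.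
  by apply: (mmap1_supported (P := fun i => `[< perp theta (e i) >])) => i;
    [move=> /pm /asboolP|move=> ->].
apply/arcsP; split=> [i|m|m m' mm'].
- by case: ifP.
- move=> npm; apply: drop0 => pm; apply: npm; split=> //.
  by apply/(LP Le); exists m.
have [pm|npm] := pselect (perp theta (weight e m)).
  by rewrite !dropE -?mm' //; apply: hb.
by rewrite !drop0 -?mm'.
Qed.

Lemma jet_in_jet_space s h : arcs R e L h -> jet_space R L e s (jet R s h).
Proof.
move=> [hL _] f fL j js.
have lift_h i : fps_eqmod s.+1 (jet_lift (jet R s h) i) (h i).
  by move=> k ks; rewrite /= -ltnS ks mxE inordK.
have fE : fps_eqmod s.+1 (mmap (@fps_const C) (jet_lift (jet R s h)) f)
                         (mmap (@fps_const C) h f).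
  rewrite /mmap; apply: fps_eqmod_sum => m _.
  by apply: fps_eqmodM; [exact: fps_eqmodxx|exact: mmap1_eqmod].
by rewrite fE // hL.
Qed.

Section LocallyClosed.
Variables (s : nat) (nu : 'rV[int]_d) (o : 'I_n -> nat).
Hypothesis nuo : orders nu o.

(** The unit part of the [i]-th coordinate of an arc, as far as its jet
    determines it. *)
Definition jet_unit (i : 'I_n) (J : 'M[C]_(n, s.+1)) : fps C :=
  Fps (fun k => if (o i + k <= s)%N then J i (inord (o i + k)) else 0).

Lemma polyfps_jet_unit i : polyfps (jet_unit i).
Proof.
move=> k; have [ok|/negbTE nok] := boolP (o i + k <= s)%N.
  have [p pE] := @polyfun_coord C n s.+1 i (inord (o i + k)).
  by exists p => x; rewrite /= ok pE.
by exists 0 => x; rewrite /= nok meval0.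
Qed.

Definition jet_binomials : set ('M[C]_(n, s.+1) -> C) :=
  [set f | exists j k m m', [/\ (k <= j <= s)%N,
     supported (fun i => o i + j <= s)%N m, supported (fun i => o i + j <= s)%N m',
     weight e m = weight e m' &
     f = fun J : 'M[C]_(n, s.+1) => fps_coef (mmap1 (jet_unit^~ J) m) k -
                  fps_coef (mmap1 (jet_unit^~ J) m') k]].

Definition jet_low_coefs : set ('M[C]_(n, s.+1) -> C) :=
  [set f | exists (i : 'I_n) (l : 'I_s.+1),
     (l < o i)%N /\ f = fun J : 'M[C]_(n, s.+1) => J i l].

Definition jet_leading (J : 'M[C]_(n, s.+1)) : C :=
  \prod_(i < n | (o i <= s)%N) J i (inord (o i)).

(** The equations express the orders of the coordinates and, for the unit parts,
    the binomial relations to the precision to which they are determined;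
    [lift_units] lifts a solution to an arc. *)
Lemma jet_arcs_ordP J : (jet R s @` arcs_ord R L e nu) J <->
  (forall f, (jet_binomials `|` jet_low_coefs) f -> f J = 0) /\
  jet_leading J != 0.
Proof.
split=> [[h /(arcs_ord_units _ nuo) [v [hv v0 vb]] <-]|[JF J0]].
  have uv i : fps_eqmod (s.+1 - o i) (jet_unit i (jet R s h)) (v i).
    move=> k ks; have oks : (o i + k <= s)%N by rewrite -ltnS -ltn_subRL.
    by rewrite /= oks mxE inordK // hv fps_coef_monM ltnNge leq_addr addKn.
  split=> [f [[j [k [m [m' [/andP[kj js] ms ms' mm' ->]]]]]|[i [l [li ->]]]]|].
  - have supp_eq p : supported (fun i => o i + j <= s)%N p ->
        fps_coef (mmap1 (jet_unit^~ (jet R s h)) p) k = fps_coef (mmap1 v p) k.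
      move=> ps; suff : fps_eqmod j.+1 (mmap1 (jet_unit^~ (jet R s h)) p)
                                       (mmap1 v p) by apply.
      apply: fps_eqmod_prod => i _.
      have [->|/ps oij] := eqVneq (p i) 0%N; first exact: fps_eqmodxx.
      apply: fps_eqmodX => l lj; apply: uv; rewrite ltn_subRL.
      by rewrite -addnS (leq_trans _ (_ : o i + j.+1 <= _)%N) ?leq_add2l // addnS.
    by rewrite !supp_eq // (vb _ _ mm') subrr.
  - by rewrite mxE hv fps_coef_monM li.
  apply/prodf_neq0 => i ois; rewrite mxE inordK // hv fps_coef_monM.
  by rewrite ltnn subnn.
have J0i i : (o i <= s)%N -> J i (inord (o i)) != 0.
  by move=> ois; move/prodf_neq0: J0; apply.
have [v [v0 vb uv]] : exists v : 'I_n -> fps C,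
    [/\ forall i, fps_coef (v i) 0 != 0, binomial_rel e v &
    forall i, (o i <= s)%N -> fps_eqmod (s - o i).+1 (v i) (jet_unit i J)].
  apply: lift_units => [i ois|j m m' js ms ms' mm' k kj].
    by rewrite /= addn0 ois J0i.
  apply/eqP; rewrite -subr_eq0; apply/eqP.
  pose f J := fps_coef (mmap1 (jet_unit^~ J) m) k -
              fps_coef (mmap1 (jet_unit^~ J) m') k.
  by apply: (JF f); left; exists j, k, m, m'; split; rewrite // -ltnS kj.
exists (fun i => fps_mon (o i) * v i).
  by apply/(arcs_ord_units _ nuo); exists v.
apply/matrixP => i l; rewrite mxE fps_coef_monM; case: ltnP => [li|il].
  by apply/esym/(JF (fun J => J i l)); right; exists i, l.
have ls : (l <= s)%N by rewrite -ltnS.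
rewrite uv ?(leq_trans il) //; last by rewrite ltnS leq_sub2r.
by rewrite /= subnKC // ls inord_val.
Qed.

Lemma jets_locally_closed :
  locally_closed_in (jet_space R L e s) (jet R s @` arcs_ord R L e nu).
Proof.
exists [set J | forall f, (jet_binomials `|` jet_low_coefs) f -> f J = 0].
exists [set J | forall f, [set jet_leading] f -> f J = 0]; split.
- apply: zariski_closed_zeros => f [[j [k [m [m' [_ _ _ _ ->]]]]]|[i [l [_ ->]]]].
    apply: polyfunB; apply: (polyfps_mmap1 (h := jet_unit));
      exact: polyfps_jet_unit.
  exact: polyfun_coord.
- apply: zariski_closed_zeros => _ ->; apply: polyfun_prod => i _.
  exact: polyfun_coord.
apply/seteqP; split=> [J JP|J [_ [JF JG]]]; last first.
  apply/jet_arcs_ordP; split=> //; apply/negP => /eqP J0; apply: JG.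
  by move=> _ ->.
have /jet_arcs_ordP [JF J0] := JP; split; last first.
  by split=> // /(_ jet_leading erefl) JG; rewrite JG eqxx in J0.
by have [h [[hL _] _] <-] := JP; apply: jet_in_jet_space.
Qed.

End LocallyClosed.

End Jets.

(** * The decomposition *)

Section Pieces.
Variables (R : realType) (d n : nat) (L : set 'rV[int]_d) (e : 'I_n -> 'rV[int]_d).
Variable s0 : nat.
Hypothesis d_gt0 : (0 < d)%N.
Hypothesis Le : smallest (@submonoid 'rV[int]_d) (range e) = L.
Hypothesis L_generates : smallest (@subgroup 'rV[int]_d) L = setT.
Hypothesis e_neq0 : forall i, e i != 0.
Hypothesis K_strict : strictly_convex (sigma_dual R L).
Hypothesis s0_gt0 : (0 < s0)%N.
Local Notation toR := (@real_of_lattice R d).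
Local Notation K := (sigma_dual R L).
Local Notation sg := (sigma R L).
Local Notation rank_low nu := (gen_rank R e (low e nu s0%:R)).
Implicit Types (nu : 'rV[int]_d) (o : 'I_n -> nat).

Lemma pairing_orders nu o i : orders e nu o ->
  pairing (toR nu) (toR (e i)) = (o i)%:R.
Proof. by move=> nuo; rewrite pairing_real_of_lattice (nuo i).1. Qed.

Lemma orders_gt0 nu o : orders e nu o ->
  forall i, 0 < pairing (toR nu) (toR (e i)).
Proof.
by move=> nuo i; rewrite (pairing_orders _ nuo) ltr0n; apply: (nuo i).2.
Qed.

Lemma relint_orders nu : relint sg (toR nu) -> exists o, orders e nu o.
Proof.
move=> /(relint_sigmaP Le e_neq0 K_strict) nup; exists (fun i => absz (pairing nu (e i))).
move=> i; have := nup i; rewrite pairing_real_of_lattice ltr0z.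
by case: (pairing nu (e i)).
Qed.

Lemma low_orders nu o i : orders e nu o ->
  (i \in low e (toR nu) s0%:R) = (o i <= s0)%N.
Proof. by move=> nuo; rewrite inE (pairing_orders _ nuo) ler_nat. Qed.

Lemma trunc_eq_orders nu nu' o o' : orders e nu o -> orders e nu' o' ->
  trunc_eq e s0%:R (toR nu) (toR nu') <->
  forall i, (o i <= s0)%N || (o' i <= s0)%N -> o i = o' i.
Proof.
move=> nuo nuo'; split=> T i; have := T i;
  rewrite (pairing_orders _ nuo) (pairing_orders _ nuo') !ler_nat => Ti ois.
  by apply/eqP; rewrite -(eqr_nat R); apply/eqP/Ti.
by rewrite Ti.
Qed.

(** What membership of [nu] in the class [i.2] amounts to; the class itself is
    expressed by [nu], since any of its elements can serve as representative. *)
Definition index_elem (i : nat * set 'rV[R]_d * set ('rV[int]_d * nat)) nu o :=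
  [/\ orders e nu o, i.1.1 = rank_low (toR nu), relint i.1.2 (toR nu) &
      i.2 = [set y | Aset_in L e i.1.1 i.1.2 y /\ Aequiv R L e i.1.1 (nu, s0) y]].

Local Notation index := [set i : nat * set 'rV[R]_d * set ('rV[int]_d * nat) |
  [/\ (1 <= i.1.1 <= d)%N, Dset R L e i.1.1 i.1.2 &
      Aclasses R L e i.1.1 i.1.2 s0 i.2]].

Lemma Aequiv_refl k x : Aequiv R L e k x x. Proof. by []. Qed.

Lemma Aequiv_sym k x y : Aequiv R L e k x y -> Aequiv R L e k y x.
Proof. by move=> [xy F]; split=> // j /F [-> ->]. Qed.

Lemma Aequiv_trans k x y z :
  Aequiv R L e k x y -> Aequiv R L e k y z -> Aequiv R L e k x z.
Proof.
move=> [xy F] [yz G]; split=> [|j jk]; first by rewrite xy.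
by have [-> ->] := F j jk; apply: G.
Qed.

Lemma index_elemP i x : index i -> i.2 x ->
  x.2 = s0 /\ exists o, index_elem i x.1 o.
Proof.
case: i x => -[k tau] c [nu s] [/= /andP[k1 kd] D [[nu' s'] [_ /= s's cE]]].
rewrite cE => -[[A rnu] Ax]; have [/= ss' F] := Ax.
have ss : s = s0 by rewrite -ss'.
split=> //; rewrite ss in A rnu Ax *; have rs : relint sg (toR nu) by have [] := A.
have [o nuo] := relint_orders rs; exists o; split=> //=.
  exact/(Aset_rank Le d_gt0 L_generates k1 s0_gt0 rs).
rewrite s's in Ax *; apply/seteqP; split=> y [Ay xy]; split=> //.
  exact: Aequiv_trans (Aequiv_sym Ax) xy.
exact: Aequiv_trans Ax xy.
Qed.

Lemma index_inhabited i : index i -> exists x, i.2 x.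
Proof.
by move=> [_ _ [x [Ax xs ->]]]; exists x; split=> //; apply: Aequiv_refl.
Qed.

Lemma index_trunc i nu nu' o o' : index i ->
    index_elem i nu o -> index_elem i nu' o' -> i.2 (nu', s0) ->
  trunc_eq e s0%:R (toR nu) (toR nu').
Proof.
move=> ind [nuo knu _ ->] [nuo' knu' _ _] [_ [_ F]].
apply: (face_eq_trunc Le L_generates _ _ knu knu') F.
  by apply/(sigmaP Le) => j; apply/ltW/(orders_gt0 nuo).
by apply/(sigmaP Le) => j; apply/ltW/(orders_gt0 nuo').
Qed.

(** The truncated values give [k] as a rank, then the faces; these give the cone
    and the class. *)
Lemma index_eq i j nu nu' o o' : index i -> index j ->
    index_elem i nu o -> index_elem j nu' o' ->
    trunc_eq e s0%:R (toR nu) (toR nu') -> i = j.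
Proof.
case: i j => -[k tau] c [[k' tau'] c'] [/= kd [mt _] _] [/= kd' [mt' _] _].
move=> [/= nuo kE rnu cE] [/= nuo' kE' rnu' cE'] T.
have kk' : k' = k by rewrite kE kE' (trunc_eq_low T).
clear kE'; subst k'; have F j : (j <= k)%N ->
    face_of L e j (toR nu) = face_of L e j (toR nu') /\
    ordJ L e j (toR nu) = ordJ L e j (toR nu').
  rewrite kE => jk; split.
    exact: (trunc_eq_face Le L_generates (orders_gt0 nuo) (orders_gt0 nuo') T jk).
  apply: (trunc_eq_ordJ Le L_generates _ _ T jk); apply/(sigmaP Le) => i.
    exact/ltW/(orders_gt0 nuo).
  exact/ltW/(orders_gt0 nuo').
have tt' : tau = tau'.
  have [_ ->] := relint_meet_fan Le L_generates kd mt rnu.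
  have [_ ->] := relint_meet_fan Le L_generates kd mt' rnu'.
  by apply/seteqP; split=> x [sx Fx]; split=> // j jk; have := Fx j jk;
    have [-> _] := F j (proj2 (andP jk)).
subst tau'; congr (_, _); rewrite cE cE'.
have Fnu : Aequiv R L e k (nu, s0) (nu', s0).
  by split=> // j /andP[_ jk]; apply: F.
apply/seteqP; split=> y [Ay xy]; split=> //.
  exact: Aequiv_trans (Aequiv_sym Fnu) xy.
exact: Aequiv_trans Fnu xy.
Qed.

(** An index is determined by the truncated values of an element of its class,
    for which there are finitely many possibilities. *)
Lemma finite_index : finite_set index.
Proof.
have /choice [x xP] : forall i, exists x : 'rV[int]_d * nat, index i -> i.2 x.
  move=> i; have [/index_inhabited [x ix]|ni] := pselect (index i).
    by exists x.
  by exists (0, 0%N).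
pose t i : {ffun 'I_n -> 'I_s0.+2} :=
  [ffun a => inord (minn s0.+1 (absz (pairing (x i).1 (e a))))].
pose i0 : nat * set 'rV[R]_d * set ('rV[int]_d * nat) := (0%N, set0, set0).
pose g (f : {ffun 'I_n -> 'I_s0.+2}) := xget i0 [set i | index i /\ t i = f].
suff : index `<=` g @` setT.
  by move=> /sub_finite_set; apply; apply: finite_image.
move=> i ii; exists (t i) => //; rewrite /g; case: xgetP => [j _ [jj tij]|].
  have [_ [o io]] := index_elemP ii (xP i ii).
  have [_ [o' jo']] := index_elemP jj (xP j jj).
  apply/esym/(index_eq ii jj io jo').
  have [nuo _ _ _] := io; have [nuo' _ _ _] := jo'.
  apply/(trunc_eq_orders nuo nuo') => a ois.
  have := congr1 (fun f : {ffun 'I_n -> 'I_s0.+2} => val (f a)) tij.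
  rewrite !ffunE /= !inordK ?ltnS ?geq_minl //.
  by rewrite (nuo a).1 (nuo' a).1 /=; move: ois; lia.
by move=> /(_ i) [].
Qed.

Lemma index_pieces_disjoint i j h h' nu nu' o o' : index i -> index j ->
    index_elem i nu o -> index_elem j nu' o' ->
    arcs_ord R L e nu h -> arcs_ord R L e nu' h' ->
    jet R s0 h = jet R s0 h' -> i = j.
Proof.
move=> ii jj io jo hnu hnu' hh'; apply: (index_eq ii jj io jo).
have [nuo _ _ _] := io; have [nuo' _ _ _] := jo.
by apply/(trunc_eq_orders nuo nuo'); apply: (common_jet_trunc Le nuo nuo' hnu hnu' hh').
Qed.

Lemma index_jets i nu nu' o o' : index i -> index_elem i nu o ->
    index_elem i nu' o' -> i.2 (nu', s0) ->
  jet R s0 @` arcs_ord R L e nu = jet R s0 @` arcs_ord R L e nu'.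
Proof.
move=> ii io io' inu'; have T := index_trunc ii io io' inu'.
have [nuo _ _ _] := io; have [nuo' _ _ _] := io'.
apply/seteqP; split; first exact/(jets_trunc Le nuo nuo')/(trunc_eq_orders nuo nuo').
by apply/(jets_trunc Le nuo' nuo)/(trunc_eq_orders nuo' nuo)/trunc_eq_sym.
Qed.

Local Notation excluded := (\bigcup_(theta in [set theta : set 'rV[R]_d |
  is_face theta sg /\ theta <> [set 0]])
     (jet R s0 @` arcs R e (L `&` perp theta))).

(** Both sides say that some nonzero face of [sigma] is orthogonal to all the
    generators of value at most [s0]. *)
Lemma jet_excluded nu o h : orders e nu o -> arcs_ord R L e nu h ->
  excluded (jet R s0 h) <->
  ~ (face_of L e (rank_low (toR nu)) (toR nu) `<=` interior K).
Proof.
move=> nuo hnu.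
have jc theta : is_face theta sg ->
    (jet R s0 @` arcs R e (L `&` perp theta)) (jet R s0 h) <->
    forall i, i \in low e (toR nu) s0%:R -> perp theta (e i).
  move=> th_face; have th_sg : theta `<=` sg.
    by have [w _ ->] := th_face; move=> x [].
  split=> [/(jet_orbit_closure Le _ nuo th_sg hnu) P i|P].
    by rewrite (low_orders _ nuo); apply: P.
  apply/(jet_orbit_closure Le _ nuo th_sg hnu) => i; rewrite -(low_orders _ nuo).
  exact: P.
have fni := face_not_interior Le L_generates (orders_gt0 nuo) (erefl (rank_low (toR nu))).
split=> [[theta [th_face th0] /(jc _ th_face) P]|/fni [theta [th_face th0 P]]].
  by apply/fni; exists theta.
by exists theta => //; apply/(jc _ th_face).
Qed.

(** For rank zero the face would contain the origin, a boundary point. *)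
Lemma rank_low_gt0 nu o : orders e nu o ->
  face_of L e (rank_low (toR nu)) (toR nu) `<=` interior K ->
  (0 < rank_low (toR nu))%N.
Proof.
move=> nuo F; rewrite lt0n; apply/eqP => k0; rewrite k0 in F.
have nup := orders_gt0 nuo.
have snu : sg (toR nu) by apply/(sigmaP Le) => i; apply: ltW.
have [B mB] := min_set_exists Le L_generates snu (leq0n d).
have nu0 : toR nu != 0.
  apply/eqP => nu0; have n0 : (0 < n)%N.
    rewrite -[n]card_ord -cardsT (leq_trans _ (gen_rank_card R e _)) //.
    by rewrite (gen_rankT_L R Le L_generates).
  by have := nup (Ordinal n0); rewrite nu0 pairing0l ltxx.
have := interior_pairing_gt0 (F _ (min_set_face mB)) snu nu0.
by rewrite pairing_vertex; have [_ _ ->] := mB; rewrite (ordJ0 Le L_generates snu) ltxx.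
Qed.

Lemma jets_decomposition :
  (jet R s0 @` arcs_star R L e) `\` excluded =
  \bigcup_(k in [set k | (1 <= k <= d)%N])
    \bigcup_(tau in Dset R L e k)
      \bigcup_(c in Aclasses R L e k tau s0)
        \bigcup_(x in c) (jet R s0 @` arcs_ord R L e x.1).
Proof.
apply/seteqP; split=> [_ [[h hs <-] nex]|_ [k kd [tau D [c cA [x cx [h hx <-]]]]]].
  have [nu [o [nuo1 nuo2 hnu]]] := arcs_star_order Le L_generates hs.
  have nuo : orders e nu o by [].
  have F : face_of L e (rank_low (toR nu)) (toR nu) `<=` interior K.
    by apply: contrapT => nF; apply: nex; apply/(jet_excluded nuo hnu).
  have k0 := rank_low_gt0 nuo F; set k := rank_low (toR nu) in F k0 *.
  have kd : (k <= d)%N by apply: rank_leq_col.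
  have nup := orders_gt0 nuo.
  have snu : sg (toR nu) by apply/(sigmaP Le) => i; apply: ltW.
  have rnu : relint (fan_cone L e k (toR nu)) (toR nu).
    exact: (relint_fan_cone Le L_generates).
  exists k; first by rewrite /= k0.
  exists (fan_cone L e k (toR nu)).
    split; first exact: meet_fan_cone.
    by exists (toR nu).
  have Anu : Aset_in L e k (fan_cone L e k (toR nu)) (nu, s0).
    split=> //; apply/(Aset_rank Le d_gt0 L_generates k0 s0_gt0) => //.
    exact/(relint_sigmaP Le e_neq0 K_strict).
  exists [set y | Aset_in L e k (fan_cone L e k (toR nu)) y /\
                  Aequiv R L e k (nu, s0) y]; first by exists (nu, s0).
  by exists (nu, s0) => //; exists h.
have ii : index (k, tau, c) by [].
have [_ [o [/= nuo kE rnu _]]] := index_elemP ii cx.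
have hs : arcs_star R L e h by have [] := hx.
split; first by exists h.
move/(jet_excluded nuo hx); rewrite -kE; apply.
have [mt [nu1 rnu1 F1]] := D.
have [_ tE] := relint_meet_fan Le L_generates kd mt rnu.
have [snu1 tE1] := relint_meet_fan Le L_generates kd mt rnu1.
apply: subset_trans F1; have := rnu1.1; rewrite tE => -[_]; apply.
by case/andP: kd => k1 _; rewrite k1 leqnn.
Qed.

End Pieces.

Theorem proposition8p11 (R : realType) (d n : nat)
    (L : set 'rV[int]_d) (e : 'I_n -> 'rV[int]_d) (s0 : nat)
    (d_gt0 : (0 < d)%N)
    (L_semigroup : submonoid L)
    (L_generates : smallest (@subgroup 'rV[int]_d) L = setT)
    (L_strict : strictly_convex (sigma_dual R L))
    (L_dim : has_dim (sigma_dual R L) d)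
    (e_gens : minimal_generators e L)
    (s0_gt0 : (0 < s0)%N) :
  let piece (c : set ('rV[int]_d * nat)) : set 'M[R[i]]_(n, s0.+1) :=
    \bigcup_(x in c) (jet R s0 @` arcs_ord R L e x.1) in
  let index : set (nat * set 'rV[R]_d * set ('rV[int]_d * nat)) :=
    [set i | [/\ (1 <= i.1.1 <= d)%N, Dset R L e i.1.1 i.1.2 &
                 Aclasses R L e i.1.1 i.1.2 s0 i.2]] in
  [/\ (jet R s0 @` arcs_star R L e) `\`
        \bigcup_(theta in [set theta : set 'rV[R]_d |
                   is_face theta (sigma R L) /\ theta <> [set 0]])
          (jet R s0 @` arcs R e (L `&` perp theta))
      = \bigcup_(k in [set k | (1 <= k <= d)%N])
          \bigcup_(tau in Dset R L e k)
            \bigcup_(c in Aclasses R L e k tau s0) piece c,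
      forall i x, index i -> i.2 x -> piece i.2 = jet R s0 @` arcs_ord R L e x.1,
      trivIset index (fun i => piece i.2),
      finite_set index &
      forall i, index i ->
        locally_closed_in (jet_space R L e s0) (piece i.2)].
Proof.
move=> piece index.
have Le : smallest (@submonoid 'rV[int]_d) (range e) = L by have [] := e_gens.
have e_neq0 i : e i != 0 by apply: minimal_generators_neq0 e_gens.
have elem i x := @index_elemP R d n L e s0 d_gt0 Le L_generates e_neq0 L_strict
  s0_gt0 i x.
have pieceE i x : index i -> i.2 x ->
    piece i.2 = jet R s0 @` arcs_ord R L e x.1.
  case: x => nu s ii ix; have [/= ss [o io]] := elem _ _ ii ix.
  apply/seteqP; split=> [J [[nu' s'] ix' JP]|J JP]; last by exists (nu, s).
  have [/= ss' [o' io']] := elem _ _ ii ix'; rewrite ss in ix.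
  have jetsE := index_jets Le L_generates ii io' io ix.
  by have : (jet R s0 @` arcs_ord R L e nu') J by []; rewrite jetsE.
split=> //.
- exact: jets_decomposition.
- move=> i j ii jj [J [[x ix [h hx <-]] [y jy [h' hy hh']]]].
  have [_ [o io]] := elem _ _ ii ix; have [_ [o' jo']] := elem _ _ jj jy.
  exact: (index_pieces_disjoint Le L_generates ii jj io jo' hx hy (esym hh')).
- exact: finite_index.
move=> i ii; have [x ix] := index_inhabited ii.
have [_ [o [nuo _ _ _]]] := elem _ _ ii ix.
by rewrite (pieceE i x ii ix); exact: (jets_locally_closed R Le s0 nuo).
Qed.
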